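(* Let $\Omega$ be a compact Hausdorff space and let $\mathcal{M}$ be a von Neumann algebra whose predual is separable and has the Radon-Nikodým property. If $f$ is a $C^*$-extreme point of the closed unit ball of the $C^*$-algebra $C(\Omega,\mathcal{M})$, then $f(\omega)$ is a $C^*$-extreme point of the closed unit ball of $\mathcal{M}$ for every $\omega\in\Omega$.
   Context: For a compact Hausdorff space $\Omega$ and a unital $C^*$-algebra $\mathcal{A}$, $C(\Omega,\mathcal{A})$ denotes the unital $C^*$-algebra of all norm-continuous functions $\Omega\to\mathcal{A}$ (norm topology on $\mathcal{A}$) with pointwise operations and supremum norm. For a unital $C^*$-algebra $\mathcal{B}$ with identity $\mathbf{1}_{\mathcal{B}}$, let $\mathcal{B}_1$ be its closed unit ball. An element $x\in\mathcal{B}_1$ is a $C^*$-extreme point of $\mathcal{B}_1$ if whenever $x=\sum_{i=1}^k t_i^*x_it_i$ with $x_1,\dots,x_k\in\mathcal{B}_1$ and invertible $t_1,\dots,t_k\in\mathcal{B}$ satisfying $\sum_{i=1}^k t_i^*t_i=\mathbf{1}_{\mathcal{B}}$, there exist unitaries $u_1,\dots,u_k\in\mathcal{B}$ with $x_i=u_i^*xu_i$ for $i=1,\dots,k$. A Banach space $X$ has the Radon-Nikodým property if for every finite measure space $(S,\Sigma,\mu)$ and every $\mu$-continuous $X$-valued countably additive measure $G:\Sigma\to X$ of bounded variation there is a Bochner integrable $g:S\to X$ with $G(E)=\int_E g\,d\mu$ for all $E\in\Sigma$. *)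

(* Defs.v *)
From HB Require Import structures.
From mathcomp Require Import all_boot all_order all_algebra.
From mathcomp Require Import all_classical all_reals all_analysis.
From mathcomp Require Import complex ring lra.
Set Implicit Arguments.
Unset Strict Implicit.
Unset Printing Implicit Defensive.
Import Order.TTheory GRing.Theory Num.Theory.
Import numFieldNormedType.Exports.
Local Open Scope classical_set_scope.
Local Open Scope ring_scope.

HB.instance Definition _ (R : realType) := NormedModule.copy R[i] R[i]^o.

(* The norm of a normed space over R[i] is R[i]-valued, so that suprema and
   integrals of norms have to be taken after projecting to R. *)
Definition rnorm (R : realType) (V : normedModType R[i]) (x : V) : R :=
  complex.Re `|x|.

Section sup_norm.
Context {R : realType}.

Definition supnorm (T : Type) (V : normedModType R[i]) (D : set T)
  (f : T -> V) : R := sup [set rnorm (f t) | t in D].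

Definition opnorm (V W : normedModType R[i]) (f : V -> W) : R :=
  supnorm [set x | `|x| <= 1] f.

End sup_norm.

Section rnorm_theory.
Context {R : realType}.
Implicit Type V : normedModType R[i].

Lemma rnormE V (x : V) : (rnorm x)%:C%C = `|x|.
Proof. by rewrite RRe_real// normr_real. Qed.

Lemma rnorm_ge0 V (x : V) : 0 <= rnorm x.
Proof. by rewrite -ler0c rnormE. Qed.

Lemma rnormD V (x y : V) : rnorm (x + y) <= rnorm x + rnorm y.
Proof. by rewrite -lecR rmorphD/= !rnormE ler_normD. Qed.

Lemma rnormZ V (l : R[i]) (x : V) : rnorm (l *: x) = rnorm l * rnorm x.
Proof. by apply: complexI; rewrite rmorphM/= !rnormE normrZ. Qed.

Lemma rnorm0 V : rnorm (0 : V) = 0.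
Proof. by apply: complexI; rewrite rnormE normr0. Qed.

Lemma rnorm0_eq0 V (x : V) : rnorm x = 0 -> x = 0.
Proof. by move=> x0; apply/normr0_eq0; rewrite -rnormE x0. Qed.

Lemma rnorm_continuous V : continuous (@rnorm R V).
Proof.
move=> x; apply/cvgrPdist_le => e e0; near=> y.
have : `|x - y| <= e%:C%C.
  by near: y; apply: (@cvgr_dist_le _ _ _ _ _ id x) => //; rewrite ltcR.
rewrite -rnormE lecR => xye.
have xE := rnormD (x - y) y; have yE := rnormD (y - x) x.
rewrite !subrK (_ : rnorm (y - x) = rnorm (x - y)) in xE yE; last first.
  by rewrite /rnorm distrC.
by rewrite ler_distl; lra.
Unshelve. all: by end_near. Qed.

End rnorm_theory.

Section supnorm_theory.
Context {R : realType} {T : Type} {V : normedModType R[i]} (D : set T).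
Implicit Types f g : T -> V.

Definition bounded_on f := exists K : R, forall t, D t -> rnorm (f t) <= K.

Lemma supnorm_ub f t : bounded_on f -> D t -> rnorm (f t) <= supnorm D f.
Proof.
move=> [K fK] Dt; apply: ub_le_sup; last by exists t.
by exists K => _ [u Du <-]; exact: fK.
Qed.

Lemma supnorm_le f (K : R) : 0 <= K -> (forall t, D t -> rnorm (f t) <= K) ->
  supnorm D f <= K.
Proof.
move=> K0 fK; rewrite /supnorm.
have [->|/set0P D0] := eqVneq D set0; first by rewrite image_set0 sup0.
apply: ge_sup; first exact: image_nonempty.
by move=> _ [t Dt <-]; exact: fK.
Qed.

Lemma supnorm_ge0 f : bounded_on f -> 0 <= supnorm D f.
Proof.
move=> bf; have [D0|/set0P[t Dt]] := eqVneq D set0.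
  by rewrite /supnorm D0 image_set0 sup0.
exact: le_trans (rnorm_ge0 _) (supnorm_ub bf Dt).
Qed.

Lemma supnormD f g : bounded_on f -> bounded_on g ->
  supnorm D (f + g) <= supnorm D f + supnorm D g.
Proof.
move=> bf bg; apply: supnorm_le; first by rewrite addr_ge0 ?supnorm_ge0.
move=> t Dt; apply: le_trans (rnormD _ _) _.
by apply: lerD; exact: supnorm_ub.
Qed.

Lemma bounded_onZ (l : R[i]) f : bounded_on f -> bounded_on (l *: f).
Proof.
move=> [K fK]; exists (rnorm l * K) => t Dt.
by rewrite rnormZ ler_wpM2l ?fK ?rnorm_ge0.
Qed.

Lemma supnormZ_le (l : R[i]) f : bounded_on f ->
  supnorm D (l *: f) <= rnorm l * supnorm D f.
Proof.
move=> bf; apply: supnorm_le; first by rewrite mulr_ge0 ?rnorm_ge0 ?supnorm_ge0.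
by move=> t Dt; rewrite rnormZ ler_wpM2l ?rnorm_ge0 ?supnorm_ub.
Qed.

End supnorm_theory.

Lemma supnormZ (R : realType) T (V : normedModType R[i]) (D : set T)
    (l : R[i]) (f : T -> V) : bounded_on D f ->
  supnorm D (l *: f) = rnorm l * supnorm D f.
Proof.
move=> bf; apply/le_anti; rewrite supnormZ_le//=.
have [->|l0] := eqVneq l 0.
  by rewrite rnorm0 mul0r supnorm_ge0//; exact: bounded_onZ.
have rl0 : 0 < rnorm l.
  by rewrite lt_def rnorm_ge0 andbT; apply: contra_neq l0; exact: rnorm0_eq0.
rewrite mulrC -ler_pdivlMr// mulrC.
have -> : (rnorm l)^-1 = rnorm l^-1.
  by apply: complexI; rewrite fmorphV/= !rnormE normfV.
have {1}-> : f = l^-1 *: (l *: f) by rewrite scalerA mulVf// scale1r.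
exact/supnormZ_le/bounded_onZ.
Qed.

(* The product is a field of the mixin, and the ring structure is derived from
   it, because Hierarchy Builder refuses a structure extending both PzRing and
   NormedModule (it would be a missing join below numDomainType). *)
HB.mixin Record isCStarAlgebra (R : realType) A
    & CompleteNormedModule R[i] A := {
  cmul : A -> A -> A;
  cone : A;
  cmulA : associative cmul;
  cmul1x : left_id cone cmul;
  cmulx1 : right_id cone cmul;
  cmulDl : left_distributive cmul +%R;
  cmulDr : right_distributive cmul +%R;
  cmulZl : forall (a : R[i]) (x y : A), cmul (a *: x) y = a *: cmul x y;
  cmulZr : forall (a : R[i]) (x y : A), cmul x (a *: y) = a *: cmul x y;
  star : A -> A;
  starK : involutive star;
  starD : {morph star : x y / x + y};
  starZ : forall (a : R[i]) (x : A), star (a *: x) = (a^*)%C *: star x;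
  starM : forall x y : A, star (cmul x y) = cmul (star y) (star x);
  cmul_norm : forall x y : A, `|cmul x y| <= `|x| * `|y|;
  cstar_norm : forall x : A, `|cmul (star x) x| = `|x| ^+ 2
}.

(* Unital; the zero algebra is allowed. *)
#[short(type="cstarAlgType")]
HB.structure Definition CStarAlgebra (R : realType) :=
  {A of CompleteNormedModule R[i] A & isCStarAlgebra R A}.

HB.instance Definition _ (R : realType) (A : cstarAlgType R) :=
  GRing.Zmodule_isPzRing.Build A cmulA cmul1x cmulx1 cmulDl cmulDr.

Section cstar_extreme_point.
Context {R : realType} {B : cstarAlgType R}.

Definition invertible (t : B) := exists s, s * t = 1 /\ t * s = 1.

Definition unitary (u : B) := star u * u = 1 /\ u * star u = 1.

Definition cstar_extreme_point (x : B) :=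
  `|x| <= 1 /\
  forall (k : nat) (xs ts : 'I_k -> B),
    (forall i, `|xs i| <= 1) ->
    (forall i, invertible (ts i)) ->
    \sum_(i < k) star (ts i) * ts i = 1 ->
    x = \sum_(i < k) star (ts i) * xs i * ts i ->
    exists u : 'I_k -> B, forall i, unitary (u i) /\
      xs i = star (u i) * x * u i.

End cstar_extreme_point.

Section cstar_theory.
Context {R : realType} {A : cstarAlgType R}.

Lemma starN (x : A) : star (- x) = - star x.
Proof. by rewrite -scaleN1r starZ rmorphN rmorph1 scaleN1r. Qed.

Lemma star_norm_le (x : A) : `|x| <= `|star x|.
Proof.
have [->|x0] := eqVneq x 0; first by rewrite normr0.
by rewrite -(@ler_pM2r _ `|x|) ?normr_gt0// -expr2 -cstar_norm; exact: cmul_norm.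
Qed.

Lemma star_norm (x : A) : `|star x| = `|x|.
Proof. by apply/le_anti; rewrite star_norm_le -{2}(starK x) star_norm_le. Qed.

Lemma star_continuous : continuous (@star R A).
Proof.
move=> x; apply/cvgrPdist_lt => e e0; near=> y.
rewrite -starN -starD star_norm; near: y.
exact: (@cvgr_dist_lt _ _ _ _ _ id x).
Unshelve. all: by end_near. Qed.

Lemma cstar_cvgM (T : Type) (F : set_system T) {FF : Filter F}
    (f g : T -> A) (a b : A) :
  f @ F --> a -> g @ F --> b -> (f \* g) @ F --> a * b.
Proof.
move=> fa gb; apply/cvgrPdist_le => e e0.
have a1 : 0 < `|a| + 1 by rewrite ltr_wpDl.
have b1 : 0 < `|b| + 1 by rewrite ltr_wpDl.
have e2 : 0 < e / 2 by rewrite divr_gt0.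
near=> t.
have -> : a * b - (f \* g) t = (a - f t) * b + f t * (b - g t).
  by rewrite mulrBl mulrBr addrA subrK.
rewrite (splitr e) (le_trans (ler_normD _ _))// lerD//.
- rewrite (le_trans (cmul_norm _ _))//.
  have fte : `|a - f t| <= e / 2 / (`|b| + 1).
    by near: t; apply: cvgr_dist_le => //; rewrite divr_gt0.
  apply: le_trans (ler_wpM2r (normr_ge0 b) fte) _.
  by rewrite mulrAC ler_pdivrMr// ler_pM2l// lerDl.
- rewrite (le_trans (cmul_norm _ _))//.
  have gte : `|b - g t| <= e / 2 / (`|a| + 1).
    by near: t; apply: cvgr_dist_le => //; rewrite divr_gt0.
  have fta : `|f t| <= `|a| + 1.
    by near: t; apply: cvgr_norm_le fa _ _; rewrite ltrDl.
  rewrite (le_trans (ler_pM _ _ fta gte))//.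
  by rewrite mulrC divfK// gt_eqF.
Unshelve. all: by end_near. Qed.

End cstar_theory.

Section continuous_functions.
Context {R : realType} {Omega : topologicalType} {A : cstarAlgType R}.

Definition ctsfun : {pred Omega -> A} := fun f => `[< continuous f >].

Lemma ctsfun_subring : subring_closed ctsfun.
Proof.
split.
- by apply/asboolP => w; exact: cvg_cst.
- move=> f g /asboolP cf /asboolP cg; apply/asboolP => w.
  exact: (cvgB (cf w) (cg w)).
- move=> f g /asboolP cf /asboolP cg; apply/asboolP => w.
  exact: (cstar_cvgM (cf w) (cg w)).
Qed.

Lemma ctsfun_scaler : GRing.scaler_closed ctsfun.
Proof.
move=> a f /asboolP cf; apply/asboolP => w.
exact: (cvgZl_tmp (k := a) (cf w)).
Qed.

HB.instance Definition _ :=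
  GRing.isSubringClosed.Build (Omega -> A) ctsfun ctsfun_subring.
HB.instance Definition _ :=
  GRing.isScaleClosed.Build R[i] (Omega -> A) ctsfun ctsfun_scaler.

(* C(Omega, A); compactness of Omega is what makes the supremum norm finite. *)
Record contfun (cO : compact [set: Omega]) := ContFun {
  contfun_val :> Omega -> A;
  contfunP : contfun_val \in ctsfun
}.

Variable cO : compact [set: Omega].
Local Notation C := (contfun cO).

HB.instance Definition _ := [isSub for @contfun_val cO].
HB.instance Definition _ := [Choice of C by <:].
HB.instance Definition _ :=
  GRing.SubChoice_isSubPzRing.Build (Omega -> A) ctsfun C ctsfun_subring.
HB.instance Definition _ := [SubZmodule_isSubLmodule of C by <:].

Implicit Types f g : C.

Lemma contfun_cts f : continuous f.
Proof. exact/asboolP/contfunP. Qed.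

Lemma contfun_bounded f : bounded_on setT f.
Proof.
have : compact [set (rnorm (f w) : R^o) | w in setT].
  apply: continuous_compact => //; apply: continuous_subspaceT => w.
  exact: continuous_comp (@contfun_cts f w) (@rnorm_continuous R A (f w)).
move=> /compact_bounded[M [_ fM]]; exists (M + 1) => w _.
apply: le_trans (ler_norm _) _.
by apply: (fM _ _ (rnorm (f w))); [rewrite ltrDl|exists w].
Qed.

Lemma contfun_ext f g : (f : Omega -> A) =1 g -> f = g.
Proof. by move=> fg; apply/val_inj/funext. Qed.

Definition contfun_norm f : R[i] := (supnorm setT f)%:C%C.

Lemma contfun_normD f g :
  contfun_norm (f + g) <= contfun_norm f + contfun_norm g.
Proof.
by rewrite -rmorphD/= lecR; apply: supnormD; exact: contfun_bounded.
Qed.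

Lemma contfun_normZ (a : R[i]) f :
  contfun_norm (a *: f) = `|a| * contfun_norm f.
Proof.
rewrite -[`|a|]rnormE -rmorphM/=; congr (_%:C)%C.
by apply: supnormZ; exact: contfun_bounded.
Qed.

Lemma contfun_norm0_eq0 f : contfun_norm f = 0 -> f = 0.
Proof.
move=> /complexI f0; apply: contfun_ext => w; apply: rnorm0_eq0.
apply/le_anti; rewrite rnorm_ge0 andbT -f0.
by apply: supnorm_ub => //; exact: contfun_bounded.
Qed.

HB.instance Definition _ := Lmodule_isNormed.Build R[i] C
  contfun_normD contfun_normZ contfun_norm0_eq0.

Lemma contfun_normE f : `|f| = (supnorm setT f)%:C%C.
Proof. by []. Qed.

Lemma contfun_norm_ub f w : `|f w| <= `|f|.
Proof.
rewrite contfun_normE -rnormE lecR.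
by apply: supnorm_ub => //; exact: contfun_bounded.
Qed.

Lemma contfun_norm_le f (e : R[i]) : 0 <= e -> (forall w, `|f w| <= e) ->
  `|f| <= e.
Proof.
move=> e0 fe; rewrite contfun_normE -(RRe_real (ger0_real e0)) lecR.
apply: supnorm_le => [|w _]; first by rewrite -ler0c RRe_real ?ger0_real.
by rewrite -lecR rnormE RRe_real ?ger0_real.
Qed.

Lemma contfun_complete (F : set_system C) :
  ProperFilter F -> cauchy F -> cvg F.
Proof.
move=> FF Fc.
have Fn (e : R[i]) : 0 < e -> \forall f & g \near F, `|f - g| < e.
  move=> e0; have := iffRL (cauchy_ballP F) Fc e e0.
  by move=> [[P Q] /= [FP FQ] PQ]; exists (P, Q).
have Fpt w : cvg ((fun f : C => f w) @ F).
  apply: cauchy_cvg; apply/cauchy_ballP => e e0.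
  have [[P Q] /= [FP FQ] PQ] := Fn _ e0.
  rewrite near_map2; exists (P, Q) => // -[f g] /PQ /= fge.
  rewrite -ball_normE /=; apply: le_lt_trans fge.
  exact: (contfun_norm_ub (f - g) w).
pose h w := lim ((fun f : C => f w) @ F).
have hF (e : R[i]) : 0 < e -> \forall f \near F, forall w, `|h w - (f : C) w| <= e.
  move=> e0; have [[P Q] /= [FP FQ] PQ] := Fn _ e0.
  apply: filterS FP => f Pf w; apply/ler_addgt0Pr => d d0.
  have hd : \forall g \near F, `|h w - (g : C) w| <= d.
    exact: cvgr_dist_le (Fpt w) _ d0.
  have [g [Qg gd]] := filter_ex (filterI FQ hd).
  rewrite -(subrK (g w) (h w)) -addrA (le_trans (ler_normD _ _))// (addrC e).
  apply: lerD => //; rewrite distrC.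
  apply: le_trans (contfun_norm_ub (f - g) w) _.
  exact/ltW/(PQ (f, g)).
have hc : h \in ctsfun.
  apply/asboolP => w; apply/cvgrPdist_le => e e0.
  have e3 : 0 < e / 3 by rewrite divr_gt0.
  have [f fe] := filter_ex (hF _ e3).
  near=> u.
  have -> : h w - h u = (h w - f w) + (f w - f u) + (f u - h u).
    by rewrite !addrA !subrK.
  rewrite (_ : e = e / 3 + e / 3 + e / 3); last by field.
  rewrite (le_trans (ler_normD _ _))// lerD//; last by rewrite distrC.
  rewrite (le_trans (ler_normD _ _))// lerD//.
  by near: u; apply: cvgr_dist_le e3; exact: contfun_cts.
apply/cvg_ex; exists (ContFun cO hc); apply/cvgrPdist_le => e e0.
near=> f; apply: contfun_norm_le; first exact: ltW.
by near: f; exact: hF.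
Unshelve. all: by end_near. Qed.

HB.instance Definition _ := Uniform_isComplete.Build C contfun_complete.

Definition contfun_star f : C :=
  @ContFun cO (star \o f) (asboolT (fun w =>
    continuous_comp (@contfun_cts f w) (@star_continuous R A (f w)))).

Lemma contfun_mulZl (a : R[i]) f g : (a *: f) * g = a *: (f * g).
Proof. by apply: contfun_ext => w; exact: cmulZl. Qed.

Lemma contfun_mulZr (a : R[i]) f g : f * (a *: g) = a *: (f * g).
Proof. by apply: contfun_ext => w; exact: cmulZr. Qed.

Lemma contfun_starK : involutive contfun_star.
Proof. by move=> f; apply: contfun_ext => w; exact: starK. Qed.

Lemma contfun_starD : {morph contfun_star : f g / f + g}.
Proof. by move=> f g; apply: contfun_ext => w; exact: starD. Qed.

Lemma contfun_starZ (a : R[i]) f :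
  contfun_star (a *: f) = (a^*)%C *: contfun_star f.
Proof. by apply: contfun_ext => w; exact: starZ. Qed.

Lemma contfun_starM f g :
  contfun_star (f * g) = contfun_star g * contfun_star f.
Proof. by apply: contfun_ext => w; exact: starM. Qed.

Lemma contfun_mul_norm f g : `|f * g| <= `|f| * `|g|.
Proof.
apply: contfun_norm_le => [|w]; first by rewrite mulr_ge0.
apply: le_trans (cmul_norm _ _) _.
by rewrite ler_pM// contfun_norm_ub.
Qed.

Lemma contfun_cstar_norm f : `|contfun_star f * f| = `|f| ^+ 2.
Proof.
apply/le_anti/andP; split.
  apply: contfun_norm_le => [|w]; first by rewrite exprn_ge0.
  have -> : `|(contfun_star f * f) w| = `|f w| ^+ 2 by exact: cstar_norm.
  by rewrite lerXn2r ?nnegrE ?contfun_norm_ub.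
rewrite -(@sqrtCK _ `|contfun_star f * f|) lerXn2r ?nnegrE ?sqrtC_ge0//.
apply: contfun_norm_le => [|w]; first by rewrite sqrtC_ge0.
rewrite -(@ler_pXn2r _ 2)// ?nnegrE ?sqrtC_ge0// sqrtCK -cstar_norm.
exact: (contfun_norm_ub (contfun_star f * f) w).
Qed.

HB.instance Definition _ := @isCStarAlgebra.Build R C
  (fun f g => f * g) 1 (@mulrA C) (@mul1r C) (@mulr1 C) (@mulrDl C) (@mulrDr C)
  contfun_mulZl contfun_mulZr
  contfun_star contfun_starK contfun_starD contfun_starZ contfun_starM
  contfun_mul_norm contfun_cstar_norm.

End continuous_functions.
Arguments contfun {R Omega} A cO.

(* The inner product is linear in its first argument. *)
HB.mixin Record isHilbert (R : realType) H
    & CompleteNormedModule R[i] H := {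
  inner : H -> H -> R[i];
  innerDl : forall x y z : H, inner (x + y) z = inner x z + inner y z;
  innerZl : forall (a : R[i]) (x y : H), inner (a *: x) y = a * inner x y;
  innerC : forall x y : H, inner y x = (inner x y)^*%C;
  inner_norm : forall x : H, inner x x = `|x| ^+ 2
}.

#[short(type="hilbertType")]
HB.structure Definition Hilbert (R : realType) :=
  {H of CompleteNormedModule R[i] H & isHilbert R H}.

Section von_neumann_algebra.
Context {R : realType} {H : hilbertType R}.

Definition bounded_operator : set (H -> H) :=
  [set T | linear T /\ continuous T].

Definition commutant (S : set (H -> H)) : set (H -> H) :=
  [set T | bounded_operator T /\ forall U, S U -> T \o U = U \o T].

(* rho identifies the C*-algebra M with a von Neumann algebra on H: a unital
   *-subalgebra of B(H), with the operator norm, equal to its bicommutant. *)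
Record von_neumann_algebra (M : cstarAlgType R) (rho : M -> H -> H) : Prop :=
  VonNeumannAlgebra {
    vN_bounded : forall x, bounded_operator (rho x);
    vN_linear : forall (a : R[i]) x y, rho (a *: x + y) = a *: rho x + rho y;
    vN_one : rho 1 = id;
    vN_mul : forall x y, rho (x * y) = rho x \o rho y;
    vN_star : forall x u v, inner (rho (star x) u) v = inner u (rho x v);
    vN_norm : forall x, opnorm (rho x) = rnorm x;
    vN_bicommutant : commutant (commutant (range rho)) = range rho
  }.

Definition square_summable (u : nat -> H) : Prop :=
  cvgn (series (fun n => rnorm (u n) ^+ 2 : R)).

Definition l2_pair :=
  {uv : (nat -> H) * (nat -> H) | square_summable uv.1 /\ square_summable uv.2}.

Context {M : cstarAlgType R}.

Definition vector_sum (rho : M -> H -> H) (uv : l2_pair) (x : M) : R[i] :=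
  limn (series (fun n => inner (rho x ((sval uv).1 n)) ((sval uv).2 n))).

(* The series in vector_sum converges absolutely whenever rho is a von Neumann
   algebra, and ultraweak is the coarsest topology making all these sums
   continuous in x. *)
Definition ultraweak (rho : M -> H -> H) : Type :=
  sup_topology (fun uv : l2_pair =>
    Topological.class (initial_topology (vector_sum rho uv))).

HB.instance Definition _ (rho : M -> H -> H) :=
  Topological.on (ultraweak rho).

Definition normal_functional (rho : M -> H -> H) : {pred M -> R[i]} :=
  fun phi => `[< [/\ linear phi, continuous phi &
                     continuous (phi : ultraweak rho -> R[i])] >].

Lemma normal_functional_submod (rho : M -> H -> H) :
  submod_closed (normal_functional rho).
Proof.
split.
  apply/asboolP; split; first by move=> a x y; rewrite scaler0 addr0.
    exact: (@cst_continuous M R[i] 0).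
  exact: (@cst_continuous (ultraweak rho) R[i] 0).
move=> a phi psi /asboolP[l1 c1 u1] /asboolP[l2 c2 u2]; apply/asboolP.
split.
- move=> b x y.
  rewrite -[LHS]/(a *: phi (b *: x + y) + psi (b *: x + y)) l1 l2.
  by rewrite !scalerDr !scalerA mulrC addrACA.
- by move=> x; exact: cvgD (cvgZl_tmp (k := a) (c1 x)) (c2 x).
- by move=> x; exact: cvgD (cvgZl_tmp (k := a) (u1 x)) (u2 x).
Qed.

HB.instance Definition _ (rho : M -> H -> H) :=
  GRing.isSubmodClosed.Build R[i] (M -> R[i]) (normal_functional rho)
    (normal_functional_submod rho).

(* The predual M_*: the ultraweakly continuous functionals on M, as a subspace
   of the dual of M, with the dual norm. *)
Record predual (rho : M -> H -> H) := Predual {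
  predual_val :> M -> R[i];
  predualP : predual_val \in normal_functional rho
}.

Variable rho : M -> H -> H.

HB.instance Definition _ := [isSub for @predual_val rho].
HB.instance Definition _ := [Choice of predual rho by <:].
HB.instance Definition _ := [SubChoice_isSubLmodule of predual rho by <:].

Implicit Types phi psi : predual rho.

Lemma predual_linear phi : linear phi.
Proof. by have /asboolP[] := predualP phi. Qed.

Lemma predual_bounded phi : bounded_on [set x : M | `|x| <= 1] phi.
Proof.
have /asboolP[lphi cphi _] := predualP phi.
pose f : {linear M -> R[i]} := HB.pack (phi : M -> R[i])
  (GRing.isLinear.Build R[i] M R[i] *:%R phi lphi).
have /linear_boundedP/pinfty_ex_gt0[r r0 fr] :=
  @continuous_linear_bounded R[i] M R[i] 0 f (cphi 0).
exists (complex.Re r) => x /= x1; rewrite -lecR rnormE RRe_real ?gtr0_real//.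
by rewrite (le_trans (fr x))// ler_piMr// ltW.
Qed.

Definition predual_norm phi : R[i] := (opnorm phi)%:C%C.

Lemma predual_normD phi psi :
  predual_norm (phi + psi) <= predual_norm phi + predual_norm psi.
Proof.
by rewrite -rmorphD/= lecR; apply: supnormD; exact: predual_bounded.
Qed.

Lemma predual_normZ (a : R[i]) phi :
  predual_norm (a *: phi) = `|a| * predual_norm phi.
Proof.
rewrite -[`|a|]rnormE -rmorphM/=; congr (_%:C)%C.
by apply: supnormZ; exact: predual_bounded.
Qed.

Lemma predual_norm0_eq0 phi : predual_norm phi = 0 -> phi = 0.
Proof.
move=> /complexI phi0; apply/val_inj/funext => x /=.
have phi00 : phi 0 = 0.
  by have := predual_linear phi (-1) 0 0; rewrite scaler0 addr0 scaleN1r addNr.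
have [->//|x0] := eqVneq x 0.
have nx0 : `|x| != 0 by rewrite normr_eq0.
have y1 : `| `|x|^-1 *: x| <= 1 by rewrite normrZ normfV normr_id mulVf.
have := supnorm_ub (predual_bounded phi) y1; rewrite -/(opnorm _) phi0.
have := predual_linear phi `|x|^-1 x 0; rewrite phi00 !addr0 => ->.
move=> r0; have /rnorm0_eq0/eqP : rnorm (`|x|^-1 *: phi x) = 0.
  by apply/le_anti; rewrite r0 rnorm_ge0.
by rewrite scaler_eq0 invr_eq0 (negPf nx0) => /eqP.
Qed.

HB.instance Definition _ := Lmodule_isNormed.Build R[i] (predual rho)
  predual_normD predual_normZ predual_norm0_eq0.

End von_neumann_algebra.

Definition separable_space (T : topologicalType) :=
  exists A : set T, countable A /\ dense A.

Section bochner_integral.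
Context {R : realType} {d : measure_display} {S : measurableType d}.
Context {X : normedModType R[i]}.
Variable mu : {finite_measure set S -> \bar R}.
Local Open Scope ereal_scope.

Definition simple (s : S -> X) : Prop :=
  finite_set (range s) /\ forall x, measurable (s @^-1` [set x]).

Definition simple_integral (E : set S) (s : S -> X) : X :=
  (\sum_(x \in range s) (fine (mu (E `&` s @^-1` [set x])))%:C%C *: x)%R.

Definition strongly_measurable (g : S -> X) : Prop :=
  exists s : nat -> S -> X, (forall n, simple (s n)) /\
    {ae mu, forall t, s ^~ t @ \oo --> g t}.

Definition bochner_approx (g : S -> X) (s : nat -> S -> X) : Prop :=
  (forall n, simple (s n)) /\
  (fun n => \int[mu]_t (rnorm (s n t - g t))%:E) @ \oo --> 0.

Definition bochner_integrable (g : S -> X) : Prop :=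
  strongly_measurable g /\ exists s, bochner_approx g s.

(* To be used for a Bochner integrable g: some approximating sequence then
   exists, and the limit does not depend on it. *)
Definition is_bochner_integral (E : set S) (g : S -> X) (v : X) : Prop :=
  forall s, bochner_approx g s -> (fun n => simple_integral E (s n)) @ \oo --> v.

Definition countably_additive (G : set S -> X) : Prop :=
  forall F : nat -> set S, (forall n, measurable (F n)) -> trivIset setT F ->
    (series (G \o F) : nat -> X) @ \oo --> G (\bigcup_n F n).

Definition abs_continuous (G : set S -> X) : Prop :=
  forall e : R, (0 < e)%R -> exists2 delta : R, (0 < delta)%R &
    forall E, measurable E -> mu E < delta%:E -> (rnorm (G E) < e)%R.

Definition bounded_variation (G : set S -> X) : Prop :=
  exists K : R, forall (n : nat) (E : 'I_n -> set S),
    (forall i, measurable (E i)) -> trivIset setT E -> \bigcup_i E i = setT ->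
    (\sum_(i < n) rnorm (G (E i)) <= K)%R.

End bochner_integral.

(* Completeness of X is not assumed, so that the notion applies to the normed
   space predual without a proof that it is a Banach space. *)
Definition radon_nikodym_property (R : realType) (X : normedModType R[i]) :=
  forall (d : measure_display) (S : measurableType d)
    (mu : {finite_measure set S -> \bar R}) (G : set S -> X),
    countably_additive G -> abs_continuous mu G -> bounded_variation G ->
    exists g : S -> X, bochner_integrable mu g /\
      forall E, measurable E -> is_bochner_integral mu E g (G E).

(* Main.v *)
From HB Require Import structures.
Require Import Defs.
From mathcomp Require Import all_boot all_order all_algebra.
From mathcomp Require Import all_classical all_reals all_analysis.
From mathcomp Require Import complex ring lra.
Set Implicit Arguments.
Unset Strict Implicit.
Unset Printing Implicit Defensive.
Import Order.TTheory GRing.Theory Num.Theory.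
Import numFieldNormedType.Exports.
Local Open Scope classical_set_scope.
Local Open Scope ring_scope.

(* Let x = f w. If c is a contraction of M, regarded as a constant function, and
   0 <= e <= 1/3, then f is the midpoint of the two contractions
   f +- e (1 - f f* ) c (1 - f* f), so that C*-extremality of f makes
   x + e (1 - x x* ) c (1 - x* x) unitarily equivalent to x. By Zorn's lemma the
   polar decomposition of x is x = v |x| with v a maximal partial isometry, that
   is (1 - v v* ) M (1 - v* v) = 0; hence some central projection q is such that
   v is isometric on the range of q and coisometric on that of 1 - q. For c = v
   the perturbation strictly increases the infimum of |x u| over the unit
   vectors u of q H unless this infimum is 1. Therefore x is isometric on q H
   and, by the same argument for x*, coisometric on (1 - q) H.

   Conversely such an x is C*-extreme. If x = sum t_i* x_i t_i with x isometric,
   then x_i t_i = t_i x and x_i is isometric; two isometries of M which are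
   similar in M are unitarily equivalent in M, because the similarity relates
   both their unitary parts and their wandering subspaces (Wold). *)

(** * Limits and the real inner product *)

(** Sequential convergence with a real-valued norm and a real [e], so that estimates stay in [R]. *)
Definition tends (R : realType) (V : normedModType R[i]) (u : nat -> V) l :=
  forall e : R, 0 < e -> exists N, forall n, (N <= n)%N -> rnorm (u n - l) < e.

Section rnorm_extra.
Context {R : realType} {V : normedModType R[i]}.
Implicit Types (u : nat -> V) (x y l : V).

Lemma rnormN x : rnorm (- x) = rnorm x.
Proof. by rewrite /rnorm normrN. Qed.

Lemma rnormB x y : rnorm (x - y) = rnorm (y - x).
Proof. by rewrite /rnorm distrC. Qed.

Lemma rnormZr (t : R) x : rnorm (t%:C%C *: x) = `|t| * rnorm x.
Proof.
rewrite rnormZ; congr (_ * _).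
by rewrite /rnorm normc_def/= expr0n/= addr0 sqrtr_sqr.
Qed.

Lemma norm_le1E x : (`|x| <= 1) = (rnorm x <= 1).
Proof. by rewrite -rnormE -lecR. Qed.

End rnorm_extra.

Section tends_theory.
Context {R : realType} {V : normedModType R[i]}.
Implicit Types (u : nat -> V) (x y l : V).

Lemma tends_le0 u l (c K : R) :
  tends u l -> (forall n, c <= K * rnorm (u n - l)) -> c <= 0.
Proof.
move=> ul cK; rewrite leNgt; apply/negP => c0.
have K0 : 0 < K.
  rewrite ltNge; apply/negP => K0; have := cK 0%N.
  have := mulr_le0_ge0 K0 (rnorm_ge0 (u 0%N - l)); lra.
have [|N uN] := ul (c / K); first exact: divr_gt0.
by have := uN N (leqnn _); rewrite ltr_pdivlMr// mulrC ltNge cK.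
Qed.

(** The form in which self-adjointness, commutation and membership in kernels pass to limits. *)
Lemma tends_closed (W : normedModType R[i]) (T : V -> W) (K : R) u l :
  (forall x y, rnorm (T x - T y) <= K * rnorm (x - y)) ->
  tends u l -> (forall n, T (u n) = 0) -> T l = 0.
Proof.
move=> TK ul Tu; apply: rnorm0_eq0; apply/le_anti; rewrite rnorm_ge0 andbT.
apply: (tends_le0 (K := K) ul) => n.
by have := TK (u n) l; rewrite Tu sub0r rnormN.
Qed.

End tends_theory.

Lemma tends_complete (R : realType) (V : completeNormedModType R[i])
    (u : nat -> V) :
  (forall e : R, 0 < e -> exists N, forall n m, (N <= n)%N -> (N <= m)%N ->
     rnorm (u n - u m) < e) -> exists l, tends u l.
Proof.
move=> uc.
have : cvg (u @ \oo).
  apply: cauchy_cvg; apply/cauchy_ballP => e e0.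
  have er : e \is Num.real by exact: gtr0_real.
  have [|N uN] := uc (complex.Re e).
    by rewrite -ltcR RRe_real.
  rewrite near_map2; exists ([set n | (N <= n)%N], [set n | (N <= n)%N]) => /=.
    by split; exists N.
  move=> [n m] /= [Nn Nm]; rewrite -ball_normE /=.
  by rewrite -rnormE -(RRe_real er) ltcR; exact: uN.
move=> /cvg_ex[l ul]; exists l => e e0.
have /cvgrPdist_lt/(_ e%:C%C) := ul; rewrite ltcR => /(_ e0)[N _ uN].
exists N => n Nn; rewrite rnormB.
by have := uN n Nn; rewrite -rnormE ltcR.
Qed.

Section real_inner.
Context {R : realType} {H : hilbertType R}.
Implicit Types (x y z : H) (a : R[i]) (t : R).

(* The real part determines the complex inner product, since multiplication by
   ['i] commutes with every operator in sight. *)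
Definition rin x y : R := complex.Re (inner x y).

Lemma rinC x y : rin x y = rin y x.
Proof. by rewrite /rin innerC; case: (inner y x). Qed.

Lemma rinDl x y z : rin (x + y) z = rin x z + rin y z.
Proof. by rewrite /rin innerDl; case: (inner x z); case: (inner y z). Qed.

Lemma rinDr x y z : rin z (x + y) = rin z x + rin z y.
Proof. by rewrite rinC rinDl !(rinC z). Qed.

Lemma rinZ a x y : rin (a *: x) y = rin x (a^*%C *: y).
Proof.
rewrite /rin innerZl (innerC (a^*%C *: y)) innerZl (innerC x y).
by case: a => p q; case: (inner x y) => r s /=; ring.
Qed.

Lemma rinZl t x y : rin (t%:C%C *: x) y = t * rin x y.
Proof. by rewrite /rin innerZl; case: (inner x y) => r s /=; ring. Qed.

Lemma rinZr t x y : rin x (t%:C%C *: y) = t * rin x y.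
Proof. by rewrite rinC rinZl rinC. Qed.

Lemma rinNl x y : rin (- x) y = - rin x y.
Proof.
have -> : - x = (-1)%:C%C *: x by rewrite rmorphN rmorph1 scaleN1r.
by rewrite rinZl mulN1r.
Qed.

Lemma rinNr x y : rin x (- y) = - rin x y.
Proof. by rewrite rinC rinNl rinC. Qed.

Lemma rin0l y : rin 0 y = 0.
Proof. by have := rinDl 0 0 y; rewrite addr0; lra. Qed.

Lemma rin0r y : rin y 0 = 0.
Proof. by rewrite rinC rin0l. Qed.

Definition rinE := (rinDl, rinDr, rinNl, rinNr, rinZl, rinZr).

Lemma rinxx x : rin x x = rnorm x ^+ 2.
Proof.
rewrite /rin inner_norm -rnormE expr2 expr2 /=; ring.
Qed.

Lemma rinxx_ge0 x : 0 <= rin x x.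
Proof. by rewrite rinxx sqr_ge0. Qed.

Lemma rin_inj x y : (forall z, rin x z = rin y z) -> x = y.
Proof.
move=> xy; apply/subr0_eq/rnorm0_eq0; apply/eqP.
by rewrite -sqrf_eq0 -rinxx rinDl rinNl xy subrr.
Qed.

Lemma rin0_eq0 x : rin x x = 0 -> x = 0.
Proof. by rewrite rinxx => /eqP; rewrite sqrf_eq0 => /eqP/rnorm0_eq0. Qed.

Lemma cauchy_schwarz x y : `|rin x y| <= rnorm x * rnorm y.
Proof.
have [y0|y0] := eqVneq (rnorm y) 0.
  by rewrite (rnorm0_eq0 y0) rin0r normr0 rnorm0 mulr0.
rewrite -(@ler_pXn2r _ 2) ?nnegrE ?mulr_ge0 ?rnorm_ge0//.
rewrite exprMn real_normK ?num_real// -!rinxx.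
have y1 : 0 < rin y y by rewrite rinxx exprn_even_gt0.
(* With [p], [q], [r] as set below, the squared norm of this vector is [r * (p * r - q ^+ 2)]. *)
have := rinxx_ge0 ((rin y y)%:C%C *: x - (rin x y)%:C%C *: y).
rewrite !rinE (rinC y x).
set p := rin x x; set q := rin x y; set r := rin y y in y1 *.
move=> pq; have : 0 <= r * (p * r - q ^+ 2) by apply: le_trans pq _; lra.
by rewrite pmulr_rge0// subr_ge0.
Qed.

Lemma rnorm_le_sqr x y : (rnorm x <= rnorm y) = (rin x x <= rin y y).
Proof. by rewrite !rinxx ler_pXn2r ?nnegrE ?rnorm_ge0. Qed.

End real_inner.

(** * Riesz representation on closed subspaces *)

Section riesz.
Context {R : realType} {H : hilbertType R}.
Implicit Types (x y z : H) (a : R[i]) (t : R).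

Definition seq_closed (K : set H) :=
  forall u l, (forall n, K (u n)) -> tends u l -> K l.

Definition linear_subspace (K : set H) :=
  K 0 /\ forall a x y, K x -> K y -> K (a *: x + y).

(* Minimise [|k|^2 - 2 phi k] over K. *)
Lemma riesz (K : set H) (phi : H -> R) (C : R) :
  linear_subspace K -> seq_closed K ->
  (forall x y, phi (x + y) = phi x + phi y) ->
  (forall t x, phi (t%:C%C *: x) = t * phi x) ->
  (forall x, `|phi x| <= C * rnorm x) ->
  exists2 k, K k & forall x, K x -> rin k x = phi x.
Proof.
move=> [K0 Klin] Kcl phiD phiZ phiC.
have KD x y : K x -> K y -> K (x + y).
  by move=> Kx Ky; rewrite -[x]scale1r; exact: Klin.
have KZ a x : K x -> K (a *: x).
  by move=> Kx; rewrite -[a *: x]addr0; exact: Klin.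
pose J x := rin x x - 2 * phi x.
pose S := [set J x | x in K].
have Slb : has_inf S.
  split; first by exists (J 0), 0.
  exists (- C ^+ 2) => _ [x Kx <-]; rewrite /J rinxx.
  have := phiC x; rewrite ler_norml => /andP[_ px].
  have := sqr_ge0 (rnorm x - C); rewrite sqrrB; lra.
set d := inf S.
have dJ x : K x -> d <= J x.
  by move=> Kx; apply: ge_inf; [exact: Slb.2|exists x].
have /choice[u uP] (n : nat) : exists x, K x /\ J x < d + n.+1%:R^-1.
  have [|_ [x Kx <-] Jx] := @inf_adherent _ S n.+1%:R^-1 _ Slb.
    by rewrite invr_gt0 ltr0n.
  by exists x.
(* Parallelogram law, with [d <= J] at the midpoint of [x] and [y]: minimising sequences are
   Cauchy. *)
have par x y : K x -> K y ->
    rin (x - y) (x - y) <= 2 * (J x - d) + 2 * (J y - d).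
  move=> Kx Ky; have := dJ _ (KZ (2^-1)%:C%C _ (KD _ _ Kx Ky)).
  rewrite /J phiZ phiD !rinE (rinC y x); lra.
have small (e : R) : 0 < e ->
    exists N : nat, forall n, (N <= n)%N -> n.+1%:R^-1 < e.
  move=> e0; exists (Num.bound e^-1) => n Nn.
  rewrite invf_plt ?posrE ?ltr0n//.
  apply: lt_le_trans (archi_boundP _) _; first by rewrite invr_ge0 ltW.
  by rewrite ler_nat leqW.
have [|k uk] := @tends_complete R H u.
  move=> e e0; have [|N NP] := small (e ^+ 2 / 4).
    by rewrite divr_gt0// exprn_gt0.
  exists N => n m Nn Nm.
  rewrite -(@ltr_pXn2r _ 2) ?nnegrE ?rnorm_ge0 ?ltW// -rinxx.
  apply: le_lt_trans (par _ _ (uP n).1 (uP m).1) _.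
  move: (uP n).2 (uP m).2 (NP _ Nn) (NP _ Nm).
  move: (J (u n)) (J (u m)) (n.+1%:R^-1) (m.+1%:R^-1) (e ^+ 2).
  move=> j1 j2 a1 a2 a3.
  by lra.
have Kk : K k by apply: Kcl uk => n; have [] := uP n.
exists k => // x Kx; apply/eqP; rewrite -subr_eq0 -normr_le0.
rewrite leNgt; apply/negP => D0.
set D := `|_| in D0.
have x1 : 0 < rnorm x + 1 by rewrite ltr_wpDl// rnorm_ge0.
(* The estimates below give [D <= 2 * e * rnorm x], whereas [D = 2 * e * (rnorm x + 1)] by this
   choice. *)
set e := D / (2 * (rnorm x + 1)).
have e0 : 0 < e by rewrite divr_gt0// mulr_gt0.
have [N1 N1P] := uk _ e0; have [N2 N2P] := small _ (exprn_gt0 2 e0).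
set n := maxn N1 N2.
have un := N1P n (leq_maxl _ _); have n2 := N2P n (leq_maxr _ _).
have [Kn Jn] := uP n.
(* [u n] minimises [J] up to [e ^+ 2], so [t ^+ 2 * rin x x + 2 * t * q] never falls below
   [- e ^+ 2]. Its minimum, at [t = - q / rin x x], gives the bound. *)
have Dn : (rin (u n) x - phi x) ^+ 2 <= rin x x * e ^+ 2.
  set q := _ - phi x.
  have H1 t : - e ^+ 2 <= t ^+ 2 * rin x x + 2 * t * q.
    have := dJ _ (KD _ _ Kn (KZ t%:C%C _ Kx)).
    rewrite /J phiD phiZ !rinE (rinC x (u n)) -/q => dJx.
    have -> : t ^+ 2 * rin x x + 2 * t * q =
      (rin (u n) (u n) + t * rin (u n) x + (t * rin (u n) x + t * (t * rin x x)) -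
        2 * (phi (u n) + t * phi x)) - J (u n) by rewrite /q /J; ring.
    move: (J (u n)) n.+1%:R^-1 Jn n2 dJx => j i Jn n2 dJx.
    by lra.
  have [x0|x0] := eqVneq (rin x x) 0.
    have [->|q0] := eqVneq q 0; first by rewrite expr0n/= x0 mul0r.
    have := H1 (- e ^+ 2 / q); rewrite x0 mulr0 add0r.
    have -> : 2 * (- e ^+ 2 / q) * q = - 2 * e ^+ 2 by field.
    have := exprn_gt0 2 e0; lra.
  have xx : 0 < rin x x by rewrite lt_def x0 rinxx_ge0.
  have := H1 (- q / rin x x).
  have -> : (- q / rin x x) ^+ 2 * rin x x + 2 * (- q / rin x x) * q =
    - (q ^+ 2 / rin x x) by field.
  by rewrite lerN2 ler_pdivrMr// mulrC.
have En : `|rin (u n) x - phi x| <= rnorm x * e.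
  rewrite -(@ler_pXn2r _ 2) ?nnegrE ?normr_ge0 ?(mulr_ge0 (rnorm_ge0 _) (ltW e0))//.
  by rewrite real_normK ?num_real// exprMn -rinxx.
have Dk : `|rin (k - u n) x| <= e * rnorm x.
  apply: le_trans (cauchy_schwarz _ _) _.
  by rewrite ler_wpM2r ?rnorm_ge0// rnormB ltW.
have : D <= rnorm x * e + e * rnorm x.
  apply: le_trans (lerD En Dk); apply: le_trans (ler_normD _ _).
  rewrite /D rinDl rinNl; suff -> : rin k x - phi x =
    rin (u n) x - phi x + (rin k x - rin (u n) x) by [].
  ring.
have eD : D = 2 * e * (rnorm x + 1) by rewrite /e; field; rewrite gt_eqF.
rewrite eD; nra.
Qed.

End riesz.

(** * Bounded operators and their adjoints *)

Section bounded_operators.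
Context {R : realType} {H : hilbertType R}.
Implicit Types (x y z : H) (a : R[i]) (t : R) (T : H -> H).

Lemma bounded_operator_bound T : bounded_operator T ->
  exists2 C, 0 <= C & forall x, rnorm (T x) <= C * rnorm x.
Proof.
move=> [lT cT].
pose f : {linear H -> H} := HB.pack T (GRing.isLinear.Build R[i] H H *:%R T lT).
have /linear_boundedP/pinfty_ex_gt0[r r0 fr] :=
  @continuous_linear_bounded R[i] H H 0 f (cT 0).
exists (complex.Re r); first by rewrite -lecR RRe_real ?gtr0_real// ltW.
by move=> x; rewrite -lecR rmorphM/= !rnormE RRe_real ?gtr0_real//; exact: fr.
Qed.

Lemma bounded_operatorP T C : linear T ->
  (forall x, rnorm (T x) <= C * rnorm x) ->
  bounded_operator T.
Proof.
move=> lT TC; split => //.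
pose f : {linear H -> H} := HB.pack T (GRing.isLinear.Build R[i] H H *:%R T lT).
apply: (@bounded_linear_continuous R[i] H H f).
apply/linear_boundedP; near=> r => x.
rewrite -rnormE; apply: le_trans (_ : (C * rnorm x)%:C%C <= _).
  by rewrite lecR; exact: TC.
rewrite rmorphM/= rnormE ler_wpM2r//.
by near: r; apply: nbhs_pinfty_ge; rewrite complex_real.
Unshelve. all: by end_near. Qed.

Lemma op_linear T : bounded_operator T ->
  [/\ forall x y, T (x + y) = T x + T y, forall a x, T (a *: x) = a *: T x
    & forall x y, T (x - y) = T x - T y].
Proof.
move=> [lT _].
pose f : {linear H -> H} := HB.pack T (GRing.isLinear.Build R[i] H H *:%R T lT).
by split; [exact: (raddfD f)|exact: (linearZ_LR f)|exact: (raddfB f)].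
Qed.

(** [S y] represents the functional sending [x] to [rin (T x) y]. Although only the real inner
    product is used, [S] is complex linear, because [rinZ] moves scalars across. *)
Lemma adjoint_exists T : bounded_operator T ->
  exists S, bounded_operator S /\ forall x y, rin (T x) y = rin x (S y).
Proof.
move=> bT; have [C C0 TC] := bounded_operator_bound bT.
have [TD TZ _] := op_linear bT.
have /choice[S SP] y : exists k, forall x, rin k x = rin (T x) y.
  have [| | | | |k _ kP] := @riesz R H setT (fun x => rin (T x) y) (C * rnorm y).
  - by split.
  - by [].
  - by move=> x z; rewrite TD rinDl.
  - by move=> t x; rewrite TZ rinZl.
  - move=> x; apply: le_trans (cauchy_schwarz _ _) _.
    by rewrite mulrAC ler_wpM2r ?rnorm_ge0.
  - by exists k => x; exact: kP.
have adj x y : rin (T x) y = rin x (S y) by rewrite -SP rinC.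
exists S; split=> //; apply: (@bounded_operatorP _ C).
  move=> a x y; apply: rin_inj => z.
  rewrite !(rinC _ z) -adj !rinDr -!adj; congr (_ + _).
  by rewrite -[in RHS](conjcK a) -rinZ -adj TZ rinZ conjcK.
move=> y; have [->|Sy0] := eqVneq (S y) 0.
  by rewrite rnorm0 mulr_ge0 ?rnorm_ge0.
have Sy : 0 < rnorm (S y).
  by rewrite lt_def rnorm_ge0 andbT; apply: contra_neq Sy0; exact: rnorm0_eq0.
rewrite -(ler_pM2r Sy) -expr2 -rinxx -adj.
apply: le_trans (ler_norm _) _; apply: le_trans (cauchy_schwarz _ _) _.
by rewrite mulrAC ler_wpM2r ?rnorm_ge0.
Qed.

End bounded_operators.

(** * Von Neumann algebras *)

Section von_neumann_theory.
Context {R : realType} {H : hilbertType R} {M : cstarAlgType R}.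
Context {rho : M -> H -> H} (vN : von_neumann_algebra rho).
Implicit Types (u v : H) (x y z p : M) (a : R[i]) (T : H -> H) (K : set H).

Local Notation N := (commutant (range rho)).

Lemma actDr x u v : rho x (u + v) = rho x u + rho x v.
Proof. by have [+ _ _] := op_linear (vN_bounded vN x); apply. Qed.

Lemma actZr a x u : rho x (a *: u) = a *: rho x u.
Proof. by have [_ + _] := op_linear (vN_bounded vN x); apply. Qed.

Lemma actBr x u v : rho x (u - v) = rho x u - rho x v.
Proof. by have [_ _] := op_linear (vN_bounded vN x); apply. Qed.

Lemma act0r x : rho x 0 = 0.
Proof. by have := actBr x 0 0; rewrite !subrr. Qed.

Lemma actDl x y u : rho (x + y) u = rho x u + rho y u.
Proof. by have := vN_linear vN 1 x y; rewrite !scale1r => ->. Qed.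

Lemma act0l u : rho 0 u = 0.
Proof.
by have := actDl 0 0 u; rewrite addr0 => /esym/(canRL (addrK _)); rewrite subrr.
Qed.

Lemma actZl a x u : rho (a *: x) u = a *: rho x u.
Proof.
have := congr1 (@^~ u) (vN_linear vN a x 0); rewrite addr0 => ->.
by rewrite -[RHS]addr0 -(act0l u).
Qed.

Lemma actNl x u : rho (- x) u = - rho x u.
Proof. by rewrite -scaleN1r actZl scaleN1r. Qed.

Lemma actBl x y u : rho (x - y) u = rho x u - rho y u.
Proof. by rewrite actDl actNl. Qed.

Lemma actM x y u : rho (x * y) u = rho x (rho y u).
Proof. by rewrite (vN_mul vN). Qed.

Lemma act1 u : rho 1 u = u.
Proof. by rewrite (vN_one vN). Qed.

Definition actE := (actDr, actBr, actZr, act0r, actDl, actBl, actZl, actNl,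
  act0l, actM, act1).

Lemma adjl x u v : rin (rho (star x) u) v = rin u (rho x v).
Proof. by rewrite /rin (vN_star vN). Qed.

Lemma adjr x u v : rin u (rho (star x) v) = rin (rho x u) v.
Proof. by rewrite rinC adjl rinC. Qed.

Lemma act_le x u : rnorm (rho x u) <= rnorm x * rnorm u.
Proof.
have [C C0 xC] := bounded_operator_bound (vN_bounded vN x).
have bx : bounded_on [set u : H | `|u| <= 1] (rho x).
  exists C => v /=; rewrite norm_le1E => v1.
  by rewrite (le_trans (xC v))// ler_piMr.
have [u0|u0] := eqVneq (rnorm u) 0.
  by rewrite (rnorm0_eq0 u0) act0r rnorm0 mulr0.
have up : 0 < rnorm u by rewrite lt_def u0 rnorm_ge0.
have := @supnorm_ub _ _ _ _ _ ((rnorm u)^-1%:C%C *: u) bx.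
rewrite /= norm_le1E rnormZr gtr0_norm ?invr_gt0// mulVf// => /(_ (lexx _)).
rewrite -/(opnorm _) (vN_norm vN) actZr rnormZr gtr0_norm ?invr_gt0//.
by rewrite mulrC ler_pdivrMr.
Qed.

Lemma act_lip x u v : rnorm (rho x u - rho x v) <= rnorm x * rnorm (u - v).
Proof. by rewrite -actBr; exact: act_le. Qed.

Lemma act_inj x y : (forall u, rho x u = rho y u) -> x = y.
Proof.
move=> xy; apply/subr0_eq/rnorm0_eq0; rewrite -(vN_norm vN).
apply/le_anti/andP; split; last first.
  by rewrite (vN_norm vN) rnorm_ge0.
by apply: supnorm_le => // u _; rewrite actBl xy subrr rnorm0.
Qed.

Lemma le_act x (C : R) : 0 <= C -> (forall u, rnorm (rho x u) <= C * rnorm u) ->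
  rnorm x <= C.
Proof.
move=> C0 xC; rewrite -(vN_norm vN); apply: supnorm_le => // u /=.
by rewrite norm_le1E => u1; rewrite (le_trans (xC u))// ler_piMr.
Qed.

Lemma commutant_act T x u : N T -> T (rho x u) = rho x (T u).
Proof. by move=> [_ /(_ (rho x))]/(_ (imageT _ _))/(congr1 (@^~ u)). Qed.

Lemma commutant_id : N id.
Proof.
split => //; apply: (@bounded_operatorP _ _ _ 1) => // u.
by rewrite mul1r.
Qed.

Lemma commutant_comp S T : N S -> N T -> N (S \o T).
Proof.
move=> NS NT; split; last first.
  by move=> _ [x _ <-]; apply/funext => u /=; rewrite !commutant_act.
have [C C0 SC] := bounded_operator_bound NS.1.
have [D D0 TD] := bounded_operator_bound NT.1.
apply: (@bounded_operatorP _ _ _ (C * D)) => [a u v /=|u /=].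
  by rewrite NT.1.1 NS.1.1.
by rewrite (le_trans (SC _))// -mulrA ler_wpM2l.
Qed.

Lemma commutant_scale a : N (fun u => a *: u).
Proof.
split; last by move=> _ [x _ <-]; apply/funext => u /=; rewrite actZr.
apply: (@bounded_operatorP _ _ _ (rnorm a)) => [b u v|u]; last by rewrite rnormZ.
by rewrite scalerDr !scalerA mulrC.
Qed.

Lemma commutant_adjoint T : N T ->
  exists2 S, N S & forall u v, rin (T u) v = rin u (S v).
Proof.
move=> NT; have [S [bS TS]] := adjoint_exists NT.1.
exists S => //; split=> // _ [x _ <-]; apply/funext => u /=.
apply: rin_inj => v; rewrite rinC -TS -adjl -commutant_act// TS.
by rewrite adjl rinC.
Qed.

(** Recognises operators built on [H] as elements of [M]. *)
Lemma bicommutant T : bounded_operator T ->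
  (forall S u, N S -> T (S u) = S (T u)) -> exists x, forall u, rho x u = T u.
Proof.
move=> bT TS; have [x _ xT] : range rho T.
  rewrite -(vN_bicommutant vN); split=> // S NS.
  by apply/funext => u /=; rewrite TS.
by exists x; rewrite xT.
Qed.

(** The orthogonal projection [P] comes from [riesz] on [K]. The commutant leaves [K] invariant and
    contains adjoints, so it commutes with [P], which therefore comes from [M]. *)
Lemma projection_exists K : linear_subspace K -> seq_closed K ->
  (forall T u, N T -> K u -> K (T u)) ->
  exists p, [/\ star p = p, p * p = p & forall u, K u <-> rho p u = u].
Proof.
move=> sK cK NK.
have /choice[P /all_and2[PK Pr]] u :
    exists k, K k /\ forall v, K v -> rin k v = rin u v.
  have [| | |k Kk kP] := @riesz R H K (rin u) (rnorm u) sK cK.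
  - by move=> v w; rewrite rinDr.
  - by move=> t v; rewrite rinZr.
  - by move=> v; exact: cauchy_schwarz.
  - by exists k.
have [K0 Klin] := sK.
have KB u v : K u -> K v -> K (u - v).
  by move=> Ku Kv; rewrite addrC -scaleN1r; exact: Klin.
have Puniq u k : K k -> (forall v, K v -> rin k v = rin u v) -> P u = k.
  move=> Kk ku; apply/subr0_eq/rin0_eq0.
  have Kd := KB _ _ (PK u) Kk.
  by rewrite rinDl rinNl Pr// ku// subrr.
have [||p pP] := @bicommutant P.
- apply: (@bounded_operatorP _ _ _ 1) => [a u v|u].
    apply: Puniq; first exact: Klin.
    move=> w Kw; rewrite !rinDl Pr// !rinZ Pr//.
    by rewrite -[a^*%C *: w]addr0; exact: Klin.
  rewrite mul1r; have [->|] := eqVneq (rnorm (P u)) 0; first exact: rnorm_ge0.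
  move=> Pu; have Pu0 : 0 < rnorm (P u) by rewrite lt_def Pu rnorm_ge0.
  rewrite -(ler_pM2r Pu0) -expr2 -rinxx Pr//.
  by rewrite (le_trans (ler_norm _))// cauchy_schwarz.
- move=> T u NT; apply: Puniq; first exact: NK.
  have [S NS TS] := commutant_adjoint NT.
  by move=> v Kv; rewrite !TS Pr//; exact: NK.
have pK u : K u -> rho p u = u by move=> Ku; rewrite pP; exact: Puniq.
exists p; split.
- apply: act_inj => u; apply: rin_inj => v; rewrite adjl !pP.
  by rewrite -(Pr u _ (PK v)) (rinC _ v) -(Pr v _ (PK u)) rinC.
- by apply: act_inj => u; rewrite actM [rho p u]pP pK.
- by move=> u; split; [exact: pK|move=> <-; rewrite pP].
Qed.

End von_neumann_theory.

(** * Square roots and absolute values *)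

Section cstar_square_root.
Context {R : realType} {A : cstarAlgType R}.
Implicit Types (x y z a b c : A) (t : R).

Lemma rnormM x y : rnorm (x * y) <= rnorm x * rnorm y.
Proof. by rewrite -lecR rmorphM/= !rnormE; exact: cmul_norm. Qed.

Lemma rnorm_star x : rnorm (star x) = rnorm x.
Proof. by rewrite /rnorm star_norm. Qed.

Lemma starB x y : star (x - y) = star x - star y.
Proof. by rewrite starD starN. Qed.

Lemma star0 : star (0 : A) = 0.
Proof. by have := starB 0 0; rewrite !subrr. Qed.

Lemma starMr x y : star (x * y) = star y * star x.
Proof. exact: starM. Qed.

Lemma star1 : star (1 : A) = 1.
Proof.
by rewrite -[LHS]mul1r -[X in X * _](starK (1 : A)) -starMr mul1r starK.
Qed.

Lemma starZr t x : star (t%:C%C *: x) = t%:C%C *: star x.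
Proof. by rewrite starZ conjc_real. Qed.

Lemma cscale_mull (k : R[i]) x y : (k *: x) * y = k *: (x * y).
Proof. exact: cmulZl. Qed.

Lemma cscale_mulr (k : R[i]) x y : x * (k *: y) = k *: (x * y).
Proof. exact: cmulZr. Qed.

Lemma sqr_lip x y (s t : R) : rnorm x <= s -> rnorm y <= t ->
  rnorm (x * x - y * y) <= (s + t) * rnorm (x - y).
Proof.
move=> xs yt.
have -> : x * x - y * y = x * (x - y) + (x - y) * y.
  by rewrite mulrBr mulrBl addrA subrK.
rewrite [X in _ <= X]mulrDl (le_trans (rnormD _ _))// lerD//.
  by rewrite (le_trans (rnormM _ _))// ler_wpM2r ?rnorm_ge0.
by rewrite (le_trans (rnormM _ _))// mulrC ler_wpM2r ?rnorm_ge0.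
Qed.

(* [r = 1 - y] where y is the limit of [y' = (1 - b + y ^ 2) / 2]; the same
   iteration in R, started at 0 with [1 - b] replaced by 1, increases to 1 and
   dominates the increments. *)
Lemma square_root b : star b = b -> rnorm (1 - b) <= 1 ->
  exists r, [/\ star r = r, r * r = b, rnorm (1 - r) <= 1
    & forall c, c * b = b * c -> c * r = r * c].
Proof.
move=> sb b1; set a := 1 - b in b1.
pose h := (2^-1 : R)%:C%C.
pose F y := h *: (a + y * y).
pose y n := iter n F 0.
pose s n : R := iter n (fun s => (1 + s ^+ 2) / 2) 0.
have hh x : rnorm (h *: x) = rnorm x / 2.
  by rewrite rnormZr gtr0_norm ?invr_gt0 ?ltr0n// mulrC.
have sS n : s n.+1 = (1 + s n ^+ 2) / 2 by [].
have s01 n : 0 <= s n <= 1.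
  elim: n => [|n /andP[s0 s1]]; first by rewrite /s/= lexx ler01.
  rewrite sS; move: (s n) s0 s1 => q q0 q1; apply/andP; split; nra.
have y_le n : rnorm (y n) <= s n.
  elim: n => [|n IH]; first by rewrite /y/s/= rnorm0.
  rewrite sS /y iterS -/(y n) hh ler_pM2r ?invr_gt0 ?ltr0n//.
  rewrite (le_trans (rnormD _ _))// lerD// (le_trans (rnormM _ _))//.
  by rewrite -expr2 lerXn2r ?nnegrE ?rnorm_ge0// (le_trans (rnorm_ge0 (y n))).
have y_inc n : rnorm (y n.+1 - y n) <= s n.+1 - s n.
  elim: n => [|n IH].
    rewrite /y /s /F/= subr0 hh mulr0 addr0 expr0n/= addr0 subr0.
    by rewrite ler_pM2r ?invr_gt0 ?ltr0n.
  have -> : y n.+2 - y n.+1 = h *: (y n.+1 * y n.+1 - y n * y n).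
    by rewrite /y !iterS -scalerBr opprD addrACA subrr add0r.
  rewrite hh ler_pdivrMr ?ltr0n//.
  apply: le_trans (sqr_lip (y_le n.+1) (y_le n)) _.
  have /andP[p0 p1] := s01 n; have /andP[q0 q1] := s01 n.+1.
  have -> : (s n.+2 - s n.+1) * 2 = (s n.+1 + s n) * (s n.+1 - s n).
    rewrite (sS n.+1); move: (s n.+1) (s n) (sS n) => S s' ->; by field.
  by apply: ler_wpM2l => //; exact: addr_ge0.
have y_cau n k : rnorm (y (n + k)%N - y n) <= s (n + k)%N - s n.
  elim: k => [|k IH]; first by rewrite addn0 !subrr rnorm0.
  rewrite addnS -(subrK (y (n + k)%N) (y _.+1)) -addrA.
  rewrite (le_trans (rnormD _ _))// (le_trans (lerD (y_inc _) IH))//.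
  by rewrite addrA subrK.
(* The gap [p = 1 - s n] becomes [p - p ^+ 2 / 2] at the next step; the product in [w0] carries the
   rate through the induction. *)
have s_to n : 1 - s n <= 2 / n.+2%:R.
  elim: n => [|n IH]; first by rewrite /s/= subr0 divff// pnatr_eq0.
  have /andP[s0 s1] := s01 n; rewrite sS.
  have n0 : 0 <= n%:R :> R by rewrite ler0n.
  rewrite -[n.+3]addn3 -[n.+2]addn2 !natrD in IH *.
  move: (n%:R : R) n0 IH => q q0; rewrite ler_pdivlMr; last by lra.
  move=> IH; rewrite ler_pdivlMr; last by lra.
  set p := 1 - s n in IH.
  have -> : 1 - (1 + s n ^+ 2) / 2 = p - p ^+ 2 / 2 by rewrite /p; field.
  have p0 : 0 <= p by rewrite subr_ge0.
  have p1 : p <= 1 by rewrite /p; lra.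
  have w0 : 0 <= (2 - p * (q + 2)) * (2 - p) by apply: mulr_ge0; lra.
  have := sqr_ge0 p; lra.
have [l yl] : exists l, tends y l.
  apply: tends_complete => e e0.
  (* From [N] on, two iterates differ by at most [2 * (1 - s N) <= 4 / N.+2%:R]. *)
  pose N := Num.bound (4 / e).
  have sN : 2 * (1 - s N) < e.
    have N0 : 0 < N.+2%:R :> R by rewrite ltr0n.
    apply: le_lt_trans (_ : 4 / N.+2%:R < e).
      by have := s_to N; move: (N.+2%:R : R) => q; lra.
    rewrite ltr_pdivrMr// mulrC -ltr_pdivrMr//.
    apply: lt_le_trans (archi_boundP _) _; first by rewrite divr_ge0// ltW.
    by rewrite ler_nat -/N leqW.
  exists N => n m Nn Nm.
  have := y_cau N (n - N)%N; have := y_cau N (m - N)%N; rewrite !subnKC//.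
  have /andP[_ s1] := s01 n; have /andP[_ s2] := s01 m.
  move=> ym yn; rewrite -(subrK (y N) (y n)) -addrA.
  rewrite (le_lt_trans (rnormD _ _))// (rnormB (y N)); lra.
have l1 : rnorm l <= 1.
  rewrite -subr_le0; apply: (tends_le0 (K := 1) yl) => n.
  have := rnormD (l - y n) (y n); rewrite subrK rnormB.
  have := y_le n; have /andP[_] := s01 n; lra.
(* [F] is 1-Lipschitz on the unit ball, so [y n.+1 = F (y n)] tends to [F l] as well as to [l]. *)
have Fl : F l = l.
  apply/subr0_eq/rnorm0_eq0/le_anti; rewrite rnorm_ge0 andbT leNgt.
  apply/negP => c0; set c := rnorm _ in c0.
  have [|n nP] := yl (c / 2); first by rewrite divr_gt0.
  have n1 := nP n (leqnn _); have n2 := nP n.+1 (leqnSn _).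
  have : c <= rnorm (F l - F (y n)) + rnorm (y n.+1 - l).
    by have := rnormD (F l - F (y n)) (F (y n) - l); rewrite addrA subrK.
  have : rnorm (F l - F (y n)) <= rnorm (y n - l).
    rewrite /F -scalerBr opprD addrACA subrr add0r hh ler_pdivrMr ?ltr0n//.
    have /andP[_ s1] := s01 n.
    apply: le_trans (sqr_lip l1 (le_trans (y_le n) s1)) _.
    by rewrite rnormB mulrC -[1 + 1]/2.
  lra.
(* The fixed point equation; it says that [(1 - l) * (1 - l) = 1 - a = b]. *)
have lE : l * l = l + l - a.
  have := congr1 (fun z => 2%:C%C *: z) Fl.
  rewrite /F scalerA /h -rmorphM/= divff ?pnatr_eq0// scale1r.
  by rewrite [2%:C%C]rmorphD/= scalerDl scale1r => <-; rewrite addrC addKr.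
exists (1 - l); split.
- rewrite starB star1; congr (_ - _); apply/subr0_eq.
  apply: (@tends_closed _ _ _ (fun z => star z - z) 2 _ _ _ yl) => [u v|n].
    have -> : star u - u - (star v - v) = star (u - v) - (u - v).
      by rewrite starB !opprD addrACA.
    by rewrite (le_trans (rnormD _ _))// rnormN rnorm_star; lra.
  suff -> : star (y n) = y n by rewrite subrr.
  elim: n => [|n IH]; first exact: star0.
  rewrite /y iterS -/(y n) /F starZr starD starMr IH.
  by rewrite /a starB star1 sb.
- have ll : l - l * l = a - l.
    by rewrite lE opprB opprD addrC !addrA subrK.
  by rewrite mulrBl mul1r mulrBr mulr1 ll opprB addrA subrK opprB addrC subrK.
- by rewrite opprB addrC subrK.
- move=> c cb; suff cl : c * l = l * c by rewrite mulrBr mulrBl cl mulr1 mul1r.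
  apply/subr0_eq.
  apply: (@tends_closed _ _ _ (fun z => c * z - z * c) (2 * rnorm c) _ _ _ yl).
    move=> u v.
    have -> : c * u - u * c - (c * v - v * c) = c * (u - v) - (u - v) * c.
      by rewrite mulrBr mulrBl !opprD addrACA.
    rewrite (le_trans (rnormD _ _))// rnormN.
    by have := rnormM c (u - v); have := rnormM (u - v) c; lra.
  move=> n; apply/eqP; rewrite subr_eq0; apply/eqP.
  elim: n => [|n IH]; first by rewrite mulr0 mul0r.
  rewrite /y iterS -/(y n) /F cscale_mulr cscale_mull; congr (_ *: _).
  rewrite mulrDr mulrDl mulrA IH -!mulrA IH; congr (_ + _).
  by rewrite /a mulrBr mulrBl mulr1 mul1r cb.
Qed.

End cstar_square_root.

Section absolute_value.
Context {R : realType} {H : hilbertType R} {M : cstarAlgType R}.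
Context {rho : M -> H -> H} (vN : von_neumann_algebra rho).
Implicit Types (u v : H) (x y z d : M).

Local Notation actE := (actE vN).

(** Turns isometry conditions between images into identities in [M]. *)
Lemma rin_gram x y u v : rin (rho x u) (rho y v) = rin (rho (star y * x) u) v.
Proof. by rewrite actE (adjl vN). Qed.

Lemma contraction_act x : rnorm x <= 1 -> forall u, rnorm (rho x u) <= rnorm u.
Proof.
move=> x1 u; rewrite (le_trans (act_le vN x u))//.
by rewrite ler_piMl ?rnorm_ge0.
Qed.

(** Scaled to a contraction [e], [d] satisfies [rnorm (1 - star e * e) <= 1], so [square_root]
    applies. Positivity of the root [r] follows from [rnorm (1 - r) <= 1] by Cauchy-Schwarz. *)
Lemma absolute_value d : exists r, [/\ star r = r, r * r = star d * d,
  forall c, c * (star d * d) = star d * d * c -> c * r = r * c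
  & forall u, 0 <= rin (rho r u) u].
Proof.
have [->|d0] := eqVneq d 0.
  exists 0; rewrite star0 !mulr0; split=> // u.
  by rewrite actE rin0l.
have dp : 0 < rnorm d.
  by rewrite lt_def rnorm_ge0 andbT; apply: contra_neq d0; exact: rnorm0_eq0.
set t := rnorm d in dp.
have tt : t * t^-1 = 1 by rewrite divff// gt_eqF.
pose e := t^-1%:C%C *: d.
have e1 : rnorm e <= 1.
  by rewrite rnormZr gtr0_norm ?invr_gt0// mulrC tt.
have de : star d * d = (t * t)%:C%C *: (star e * e).
  rewrite starZr cscale_mull cscale_mulr !scalerA -!rmorphM/=.
  rewrite [X in X%:C%C *: _](_ : _ = 1) ?scale1r//.
  by field; rewrite gt_eqF.
clearbody e.
have [||r [sr rr r1 rc]] := @square_root _ M (star e * e).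
- by rewrite starMr starK.
- apply: (le_act vN) => // u; rewrite mul1r rnorm_le_sqr !actE !rinE.
  have eu := contraction_act e1 u.
  have seu : rnorm (rho (star e) (rho e u)) <= rnorm (rho e u).
    by apply: contraction_act; rewrite rnorm_star.
  rewrite rnorm_le_sqr in seu.
  have uq : rin u (rho (star e) (rho e u)) = rin (rho e u) (rho e u).
    exact: (adjr vN).
  rewrite (rinC (rho (star e) _) u) uq.
  have := rinxx_ge0 (rho e u); lra.
exists (t%:C%C *: r); split.
- by rewrite starZr sr.
- by rewrite cscale_mull cscale_mulr scalerA -rmorphM/= rr de.
- move=> c; rewrite de cscale_mulr cscale_mull => cd.
  rewrite cscale_mulr cscale_mull; congr (_ *: _); apply: rc.
  have := congr1 (fun z => (t^-1 * t^-1)%:C%C *: z) cd.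
  rewrite !scalerA -!rmorphM/=.
  have -> : t^-1 * t^-1 * (t * t) = 1 by field; rewrite gt_eqF.
  by rewrite !scale1r.
- move=> u; rewrite actE rinZl mulr_ge0 ?(ltW dp)//.
  have ru := contraction_act r1 u.
  have := le_trans (cauchy_schwarz _ _) (ler_wpM2r (rnorm_ge0 u) ru).
  rewrite -expr2 -rinxx ler_norml => /andP[_].
  by rewrite !actE !rinE; lra.
Qed.

Lemma rnorm_absolute_value d r u : star r = r -> r * r = star d * d ->
  rnorm (rho r u) = rnorm (rho d u).
Proof.
move=> sr rr; apply/le_anti.
by rewrite !rnorm_le_sqr !rin_gram sr rr lexx.
Qed.

End absolute_value.

(** * Maximal partial isometries *)

Lemma rin_tends (R : realType) (H : hilbertType R) (f g : nat -> H) u v x y :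
  tends f u -> tends g v -> (forall i, rin (f i) x = rin (g i) y) ->
  rin u x = rin v y.
Proof.
move=> fu gv fg; apply/eqP; rewrite -subr_eq0 -normr_le0 leNgt; apply/negP.
set c := `|_| => c0; set C := rnorm x + rnorm y + 1.
have C0 : 0 < C by rewrite ltr_wpDl// addr_ge0 ?rnorm_ge0.
have [|n nP] := fu (c / C); first exact: divr_gt0.
have [|m mP] := gv (c / C); first exact: divr_gt0.
set i := maxn n m.
have fi := nP i (leq_maxl _ _); have gi := mP i (leq_maxr _ _).
have cE : c <= rnorm (f i - u) * rnorm x + rnorm (g i - v) * rnorm y.
  have := cauchy_schwarz (f i - u) x; have := cauchy_schwarz (g i - v) y.
  move=> h1 h2; rewrite addrC; apply: le_trans (lerD h1 h2).
  rewrite !rinDl !rinNl fg; apply: le_trans (ler_normB _ _).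
  suff -> : rin (g i) y - rin v y - (rin (g i) y - rin u x) =
    rin u x - rin v y by [].
  by ring.
have cC : c = c / C * C by rewrite divfK// gt_eqF.
have := ler_wpM2r (rnorm_ge0 x) (ltW fi); have := ler_wpM2r (rnorm_ge0 y) (ltW gi).
have d0 : 0 < c / C by exact: divr_gt0.
rewrite /C in cC d0 *; move: (c / _) cC d0 => d cd d0; lra.
Qed.

Section isometric_relations.
Context {R : realType} {H : hilbertType R} {M : cstarAlgType R}.
Context {rho : M -> H -> H} (vN : von_neumann_algebra rho).
Implicit Types (u v : H) (x y z d : M) (T : H -> H) (G : set (H * H)).

Local Notation N := (commutant (range rho)).
Local Notation actE := (actE vN).

(* Graphs, possibly not closed under addition, of isometries between subsets of
   H commuting with the commutant. As ['i] is in the commutant, preservation of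
   the real inner product amounts to that of the complex one. *)
Definition isometric_relation G :=
  (forall a b, G a -> G b -> rin a.1 b.1 = rin a.2 b.2) /\
  (forall T a, N T -> G a -> G (T a.1, T a.2)).

(** If [(u, v)] is compatible with a maximal relation, its orbit under the commutant can be
    adjoined. It is enough to compare [rin (T u) u] with [rin (T v) v], since the commutant is
    closed under composition and adjoints. *)
Lemma maximal_isometric_relation G0 : isometric_relation G0 ->
  exists G, [/\ G0 `<=` G, isometric_relation G &
    forall u v, (forall a, G a -> rin a.1 u = rin a.2 v) ->
      (forall T, N T -> rin (T u) u = rin (T v) v) -> G (u, v)].
Proof.
move=> [G0iso G0N].
(* The predicate bears on the union with [G0], so that the union of the empty chain satisfies it. *)
have [F FP Ftot|G [[GI GN] Gmax]] :=
  @Zorn_bigcup (H * H)%type (fun G => isometric_relation (G0 `|` G)).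
  split.
    move=> a b [a0|[A FA Aa]] [b0|[B FB Bb]]; first exact: G0iso.
    - by apply: (FP _ FB).1; [left|right].
    - by apply: (FP _ FA).1; [right|left].
    - have [AB|BA] := Ftot _ _ FA FB.
        by apply: (FP _ FB).1; right => //; exact: AB.
      by apply: (FP _ FA).1; right => //; exact: BA.
  move=> T a NT [a0|[A FA Aa]]; first by left; exact: G0N.
  have [|Ta|Ta] := (FP _ FA).2 T a NT; first by right.
    by left.
  by right; exists A.
exists (G0 `|` G); split=> [a||u v uv Nuv]; [by left|by split|].
pose G' := [set a | exists2 T, N T & a = (T u, T v)].
have NuvS S T : N S -> N T -> rin (S u) (T u) = rin (S v) (T v).
  move=> NS NT; have [T' NT' TT'] := commutant_adjoint vN NT.
  have E w : rin (S w) (T w) = rin (T' (S w)) w by rewrite rinC TT' rinC.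
  by rewrite (E u) (E v); exact: (Nuv _ (commutant_comp NT' NS)).
have guv a T : (G0 `|` G) a -> N T -> rin a.1 (T u) = rin a.2 (T v).
  move=> Ga NT; have [S NS TS] := @commutant_adjoint _ _ _ _ vN T NT.
  have E w b : rin b (T w) = rin (S b) w by rewrite rinC TS rinC.
  by rewrite (E u) (E v); exact: (uv _ (GN _ _ NS Ga)).
have G'max : isometric_relation (G0 `|` (G `|` G')).
  rewrite setUA; split.
    move=> a b [Ga|[S NS ->]] [Gb|[T NT ->]]; first exact: GI.
    - exact: guv.
    - by rewrite rinC [RHS]rinC; exact: guv.
    - exact: NuvS.
  move=> T a NT [Ga|[S NS ->]]; first by left; exact: GN.
  by right; exists (T \o S) => //; exact: commutant_comp.
have G'u : G' (u, v) by exists id => //; exact: commutant_id.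
apply: contrapT => nG; apply: (Gmax (G `|` G')) => //.
split; first by move=> a; left.
by move=> /(_ (u, v)) sG; apply: nG; right; apply: sG; right.
Qed.

(** Maximality makes a maximal relation a closed linear graph, whose domain is the range of a
    projection [p] of [M]. The partial isometry [x] follows this graph on the domain and vanishes on
    its orthogonal complement. *)
Lemma partial_isometry_exists G0 : isometric_relation G0 ->
  exists x, [/\ x * star x * x = x,
    forall a, G0 a -> rho x a.1 = a.2 /\ rho (star x * x) a.1 = a.1
    & forall d, (1 - x * star x) * d * (1 - star x * x) = 0].
Proof.
move=> /maximal_isometric_relation[G [G0G [GI GN] Gmax]].
have GD a b (k : R[i]) : G a -> G b -> G (k *: a.1 + b.1, k *: a.2 + b.2).
  move=> Ga Gb; have Gka := GN _ _ (commutant_scale vN k) Ga.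
  apply: Gmax => /= [c Gc|T NT].
    by rewrite !rinDr; congr (_ + _); [exact: GI Gc Gka|exact: GI Gc Gb].
  have [TD _ _] := op_linear NT.1; rewrite !TD !rinDl !rinDr.
  congr (_ + _ + (_ + _)).
  - exact: GI (GN _ _ NT Gka) Gka.
  - exact: GI (GN _ _ NT Gka) Gb.
  - exact: GI (GN _ _ NT Gb) Gka.
  - exact: GI (GN _ _ NT Gb) Gb.
have Gn a : G a -> rnorm a.1 = rnorm a.2.
  by move=> Ga; apply/le_anti; rewrite !rnorm_le_sqr !GI// lexx.
have GB a b : G a -> G b -> G (a.1 - b.1, a.2 - b.2).
  move=> Ga Gb; have := GD _ _ (-1) Gb Ga.
  by rewrite !scaleN1r ![- _ + _]addrC.
have Gfun u v w : G (u, v) -> G (u, w) -> v = w.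
  move=> uv uw; apply/subr0_eq/rnorm0_eq0.
  by have := Gn _ (GB _ _ uv uw) => /= <-; rewrite subrr rnorm0.
pose K := [set u | exists v, G (u, v)].
have G00 : G (0, 0).
  by apply: Gmax => [a _|T NT]; rewrite !rin0r.
have lK : linear_subspace K.
  split; first by exists 0.
  by move=> a u v [u' uu] [v' vv]; exists (a *: u' + v'); exact: (GD _ _ a uu vv).
have cK : seq_closed K.
  move=> f u /choice[g fg] fu.
  have [v gv] : exists v, tends g v.
    apply: tends_complete => e e0; have [|n nP] := fu (e / 2).
      by rewrite divr_gt0.
    exists n => i j ni nj; rewrite -(Gn _ (GB _ _ (fg i) (fg j)))/=.
    have := rnormD (f i - u) (u - f j); rewrite addrA subrK (rnormB u).
    have := nP _ ni; have := nP _ nj; lra.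
  have uv a : G a -> rin a.1 u = rin a.2 v.
    move=> Ga; rewrite rinC [RHS]rinC; apply: (rin_tends fu gv) => i.
    exact: (GI _ _ (fg i) Ga).
  exists v; apply: Gmax => // T NT; have [S NS TS] := commutant_adjoint vN NT.
  rewrite !TS; apply: (rin_tends fu gv) => i; rewrite -!TS.
  exact: (uv _ (GN _ _ NT (fg i))).
have NK T u : N T -> K u -> K (T u).
  by move=> NT [v uv]; exists (T v); exact: (GN _ _ NT uv).
have [p [sp pp pK]] := projection_exists vN lK cK NK.
have pKp u : K (rho p u) by apply/pK; rewrite -(actM vN) pp.
have /choice[X XP] u : exists v, G (rho p u, v) by exact: pKp.
have [||x xX] := @bicommutant _ _ _ _ vN X.
- apply: (@bounded_operatorP _ _ _ (rnorm p)) => [a u v|u].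
    apply: Gfun (XP _) _; rewrite !actE; exact: (GD _ _ a (XP u) (XP v)).
  by rewrite -(Gn _ (XP u))/=; exact: act_le.
- move=> T u NT; apply: Gfun (XP _) _.
  by rewrite -(commutant_act _ _ NT); exact: (GN _ _ NT (XP u)).
have xx : star x * x = p.
  apply: (act_inj vN) => u; apply: rin_inj => v.
  rewrite actE (adjl vN) !xX -(GI _ _ (XP u) (XP v))/=.
  by rewrite -(adjl vN) sp -actM// pp.
have xp : x * p = x.
  apply: (act_inj vN) => u; rewrite actE !xX.
  by apply: Gfun (XP _) _; rewrite -(actM vN) pp.
have Gx u v : G (u, v) -> rho x u = v /\ rho p u = u.
  move=> uv; have pu : rho p u = u by apply/pK; exists v.
  by split=> //; rewrite xX; apply: Gfun uv; have := XP u; rewrite pu.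
exists x; rewrite xx; split.
- by rewrite -mulrA xx.
- by move=> [u v] /G0G/Gx.
(* The pairs [(rho r u, rho d' u)], with [r] the absolute value of [d'], are orthogonal to [G] on
   both sides and thus lie in [G] by maximality. But [p * r = 0], so they vanish. *)
move=> d; set d' := _ * _.
have [r [sr rr rc rp]] := absolute_value vN d'.
have d'p : d' * p = 0.
  by rewrite /d' -mulrA [(1 - p) * p]mulrBl mul1r pp subrr mulr0.
have xd' : star x * d' = 0.
  have px : p * star x = star x by rewrite -{1}sp -starMr xp.
  have e0 : star x * (1 - x * star x) = 0.
    by rewrite mulrBr mulr1 mulrA xx px subrr.
  by rewrite /d' !mulrA e0 !mul0r.
have pr : p * r = 0.
  have rp0 : r * p = 0.
    apply: (act_inj vN) => u; rewrite !actE; apply: rnorm0_eq0.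
    by rewrite (rnorm_absolute_value vN _ sr rr) -actM// d'p actE rnorm0.
  by rewrite -sp -{1}sr -starMr rp0 star0.
have Gr u : G (rho r u, rho d' u).
  apply: Gmax => [[v w] /Gx[<- pv]|T NT] /=.
    by rewrite -{1}pv -{1}sp (adjl vN) -(adjr vN) -!(actM vN) pr xd' !actE !rin0r.
  by rewrite !(commutant_act _ _ NT) !(rin_gram vN) sr rr.
apply: (act_inj vN) => u; have [rd pru] := Gx _ _ (Gr u).
by rewrite -rd -pru -(actM vN p) pr !actE.
Qed.

End isometric_relations.

(** * Values of C*-extreme functions *)

Section central_projections.
Context {R : realType} {H : hilbertType R} {M : cstarAlgType R}.
Context {rho : M -> H -> H} (vN : von_neumann_algebra rho).
Implicit Types (u : H) (x y z d p q : M).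

Local Notation N := (commutant (range rho)).
Local Notation actE := (actE vN).

Definition central_projection q :=
  [/\ star q = q, q * q = q & forall x, q * x = x * q].

Lemma central_projectionC q : central_projection q -> central_projection (1 - q).
Proof.
move=> [sq qq qx]; split=> [||x]; first by rewrite starB star1 sq.
  by rewrite mulrBl mul1r mulrBr mulr1 qq subrr subr0.
by rewrite mulrBl mulrBr mul1r mulr1 qx.
Qed.

(* The range of the projection is the orthogonal complement of the central
   support of [1 - star x * x]. *)
Lemma central_splitting x :
  (forall d, (1 - x * star x) * d * (1 - star x * x) = 0) ->
  exists q, [/\ central_projection q, star x * x * q = q
    & x * star x * (1 - q) = 1 - q].
Proof.
set e := 1 - star x * x; set f := 1 - x * star x => fe.
have se : star e = e by rewrite starB star1 starMr starK.
have sf : star f = f by rewrite starB star1 starMr starK.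
have ef d : e * d * f = 0.
  by rewrite -se -sf -[d]starK -!starMr mulrA fe star0.
pose K := [set u | forall d, rho (e * d) u = 0].
have [|||q [sq qq qK]] := @projection_exists _ _ _ _ vN K.
- split=> [d|a u v Ku Kv d]; first by rewrite actE.
  by rewrite actDr// actZr// Ku Kv scaler0 addr0.
- move=> s u Ks su d.
  by apply: (tends_closed (act_lip vN (e * d)) su) => n; exact: Ks.
- move=> T u NT Ku d; rewrite -(commutant_act _ _ NT) Ku.
  by have [_ _ TB] := op_linear NT.1; have := TB 0 0; rewrite !subrr.
have Kq u : K (rho q u) by apply/qK; rewrite -(actM vN) qq.
(* [K] is invariant under [M]; taking adjoints then shows that [q] is central. *)
have qxq d : q * d * q = d * q.
  apply: (act_inj vN) => u; rewrite !(actM vN); apply/qK => c.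
  by rewrite -(actM vN) -mulrA; exact: (Kq u (c * d)).
have qx d : q * d = d * q.
  by rewrite -qxq -[LHS]starK starMr sq -qxq !starMr sq starK mulrA.
exists q; split; first by split.
  have eq : e * q = 0.
    by apply: (act_inj vN) => u; rewrite -[e]mulr1 (actM vN) Kq actE.
  by apply/esym/subr0_eq; rewrite -[X in X - _]mul1r -mulrBl eq.
(* By [ef] the range of [f] lies in [K]. *)
have qf : q * f = f.
  apply: (act_inj vN) => u; rewrite (actM vN); apply/qK => d.
  by rewrite -(actM vN) ef actE.
have {}qf : f * (1 - q) = 0 by rewrite mulrBr mulr1 -qx qf subrr.
by apply/esym/subr0_eq; rewrite -[X in X - _]mul1r -mulrBl qf.
Qed.

End central_projections.

(** * Perturbation of a contraction by its defects *)

Section perturbation.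
Context {R : realType} {H : hilbertType R} {M : cstarAlgType R}.
Context {rho : M -> H -> H} (vN : von_neumann_algebra rho).
Implicit Types (u : H) (x y z c d p q v : M) (e : R).

Local Notation actE := (actE vN).

Lemma rin_act_star x u : rin u (rho (star x * x) u) = rin (rho x u) (rho x u).
Proof. by rewrite actM// (adjr vN). Qed.

(** The left side is [|u|^2 - 2 |x u|^2 + |x* x u|^2], and [|x* x u| <= |x u|]. *)
Lemma defect_le x u : rnorm x <= 1 ->
  rin (rho (1 - star x * x) u) (rho (1 - star x * x) u) <=
    rin u u - rin (rho x u) (rho x u).
Proof.
move=> x1; rewrite actBl// act1// !rinE (rinC (rho _ u) u) rin_act_star.
have x1' : rnorm (star x) <= 1 by rewrite rnorm_star.
have := contraction_act vN x1' (rho x u).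
by rewrite rnorm_le_sqr -actM//; lra.
Qed.

Lemma isometric_at x u : rnorm x <= 1 -> rnorm (rho x u) = rnorm u ->
  rho (star x * x) u = u.
Proof.
move=> x1 xu; apply/esym/subr0_eq/rin0_eq0/le_anti; rewrite rinxx_ge0 andbT.
have := defect_le u x1; rewrite !actBl// act1//.
by rewrite !rinxx xu subrr.
Qed.

Lemma perturbation_le x c e : rnorm x <= 1 -> rnorm c <= 1 -> `|e| <= 3^-1 ->
  rnorm (x + e%:C%C *: ((1 - x * star x) * c * (1 - star x * x))) <= 1.
Proof.
move=> x1 c1 e3; apply: (le_act vN) => // u.
have sx1 : rnorm (star x) <= 1 by rewrite rnorm_star.
rewrite mul1r actDl// actZl// -mulrA !(actM vN) rnorm_le_sqr.
have du := defect_le u x1.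
set w := rho (1 - star x * x) u in du *.
set z := rho c w.
have zw : rin z z <= rin w w by rewrite -rnorm_le_sqr contraction_act.
have bz : rin (rho (1 - x * star x) z) (rho (1 - x * star x) z) <= rin z z.
  have := defect_le z sx1; rewrite starK.
  have := rinxx_ge0 (rho (star x) z); lra.
have xz : `|rin (rho x u) (rho (1 - x * star x) z)| <= rin w w.
  have -> : rin (rho x u) (rho (1 - x * star x) z) = rin (rho x w) z.
    rewrite -[X in rho X z]starK (adjr vN) starB star1 starMr starK.
    rewrite -!(actM vN); congr (rin (rho _ u) z).
    by rewrite mulrBl mul1r mulrBr mulr1 mulrA.
  apply: le_trans (cauchy_schwarz _ _) _.
  rewrite rinxx expr2 ler_pM ?rnorm_ge0 ?contraction_act//.
rewrite !rinE (rinC (rho (1 - _) z)).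
move: xz; set p := rin (rho x u) _; set s := rin (rho _ z) _ in bz *.
set t := rin w w in zw du * => pt.
have ep : `|e * p| <= 3^-1 * t by rewrite normrM ler_pM.
have es : e * (e * s) <= 9^-1 * t.
  rewrite mulrA -expr2 -(real_normK (num_real e)).
  have s0 : 0 <= s by exact: rinxx_ge0.
  have -> : (9^-1 : R) = 3^-1 ^+ 2 by field.
  apply: ler_pM; rewrite ?exprn_ge0//; last by lra.
  by rewrite lerXn2r ?nnegrE// invr_ge0.
move: ep; rewrite ler_norml => /andP[_ ep].
have t0 : 0 <= t by exact: rinxx_ge0.
lra.
Qed.

(** Let [i] be the infimum of [|x u|^2] over the unit vectors [u] in the range of [q]. [U] permutes
    these vectors, and the perturbation raises [|x u|^2] by at least [e^2 (1 - |x u|^2)^4]. Hence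
    [i + e^2 (1 - i)^4 <= i], which forces [i = 1]. *)
Lemma rigid_isometric x v q U (e : R) : 0 < e -> e <= 3^-1 ->
  rnorm x <= 1 -> central_projection q -> star v * v * q = q ->
  (forall u, 0 <= rin (rho (star v * x) u) u) ->
  (1 - x * star x) * v = v * (1 - star x * x) ->
  unitary U ->
  x + e%:C%C *: ((1 - x * star x) * v * (1 - star x * x)) = star U * x * U ->
  star x * x * q = q.
Proof.
move=> e0 e3 x1 [sq qq qx] vq vx bv [U1 U2] yU.
set a := 1 - star x * x in bv yU; set b := 1 - x * star x in bv yU.
have sa : star a = a by rewrite starB star1 starMr starK.
have sb : star b = b by rewrite starB star1 starMr starK.
have vxa : star v * x * a = a * (star v * x).
  have -> : star v * x * a = star v * b * x.
    by rewrite -!mulrA; congr (_ * _); rewrite mulrBl mulrBr mul1r mulr1 mulrA.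
  by rewrite -{1}sb -starMr bv starMr sa mulrA.
have adja u w : rin (rho a u) w = rin u (rho a w) by rewrite -{1}sa (adjl vN).
(* The right side is the squared norm of [x u + e v a^2 u]. Its cross term is nonnegative because
   [star v * x] is positive and commutes with [a]; in the last term [v] is isometric on the range of
   [q]. *)
have stepP u : rho q u = u -> rnorm u = 1 ->
  rin (rho x u) (rho x u) + e ^+ 2 * (1 - rin (rho x u) (rho x u)) ^+ 4 <=
  rin (rho x (rho U u)) (rho x (rho U u)).
  move=> qu u1; set t := rin (rho x u) (rho x u).
  have -> : rin (rho x (rho U u)) (rho x (rho U u)) =
      rin (rho (star U * x * U) u) (rho (star U * x * U) u).
    by rewrite !(actM vN) (adjl vN) -!(actM vN) U2 mul1r.
  rewrite -yU bv actDl// actZl// !rinE (rinC (rho (v * a * a) u)).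
  have -> : rin (rho x u) (rho (v * a * a) u) =
      rin (rho (star v * x) (rho a u)) (rho a u).
    by rewrite -[in RHS](actM vN _ a) vxa !(actM vN) adja (adjl vN).
  have -> : rin (rho (v * a * a) u) (rho (v * a * a) u) =
      rin (rho (a * a) u) (rho (a * a) u).
    rewrite -mulrA (actM vN) -(adjl vN) -(actM vN).
    suff -> : rho (star v * v) (rho (a * a) u) = rho (a * a) u by [].
    by rewrite -{1}qu -!(actM vN) -!mulrA -qx (mulrA a) -qx !mulrA vq -!mulrA
      !qx !(actM vN) qu.
  rewrite -/t; set s := rin (rho (star v * x) _) _.
  set r := rin (rho (a * a) u) _.
  have s0 : 0 <= s by exact: vx.
  have t1 : rin (rho a u) u = 1 - t.
    by rewrite actBl// act1// !rinE (rinC _ u) rin_act_star rinxx u1 expr1n.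
  have cs w : rin w u ^+ 2 <= rin w w.
    have := cauchy_schwarz w u; rewrite u1 mulr1 => h.
    rewrite [leRHS]rinxx -(real_normK (num_real (rin w u))).
    by rewrite lerXn2r ?nnegrE ?rnorm_ge0.
  (* Cauchy-Schwarz against the unit vector [u], twice: [|a^2 u|^2 >= |a u|^4 >= (1 - t)^4]. *)
  have r1 : (1 - t) ^+ 4 <= r.
    apply: le_trans (cs _).
    rewrite (actM vN) adja -t1 (_ : 4 = 2 * 2)%N// exprM.
    by rewrite lerXn2r ?nnegrE ?sqr_ge0 ?rinxx_ge0// cs.
  have e2 : 0 <= e ^+ 2 by rewrite sqr_ge0.
  have := ler_wpM2l e2 r1; have := mulr_ge0 (ltW e0) s0.
  rewrite expr2; move: ((1 - t) ^+ 4) => k; lra.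
pose W := [set u | rho q u = u /\ rnorm u = 1].
pose S := [set rin (rho x u) (rho x u) | u in W].
have xW u : W u -> 1 <= rin (rho x u) (rho x u).
  move=> Wu; have Si : has_inf S.
    split; first by exists (rin (rho x u) (rho x u)), u.
    by exists 0 => _ [u' _ <-]; exact: rinxx_ge0.
  have iS u' : W u' -> inf S <= rin (rho x u') (rho x u').
    by move=> Wv; apply: ge_inf; [exact: Si.2|exists u'].
  have x_le1 u' : W u' -> rin (rho x u') (rho x u') <= 1.
    move=> [_ v1]; rewrite -(expr1n _ 2) -[X in _ <= X ^+ 2]v1 -rinxx -rnorm_le_sqr.
    exact: contraction_act.
  set i := inf S in iS; have i1 := le_trans (iS _ Wu) (x_le1 _ Wu).
  have i0 : 0 <= i.
    by apply: lb_le_inf; [exact: Si.1|move=> _ [u' _ <-]; exact: rinxx_ge0].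
  have : i + e ^+ 2 * (1 - i) ^+ 4 <= i.
    apply: lb_le_inf; first exact: Si.1.
    move=> _ [u' [qv v1] <-].
    have Wv : W (rho (star U) u').
      split; first by rewrite -(actM vN) qx (actM vN) qv.
      by apply/le_anti;
        rewrite -v1 !rnorm_le_sqr (adjl vN) -(actM vN) U2 act1// lexx.
    have := stepP _ Wv.1 Wv.2; rewrite -(actM vN U) U2 act1//.
    have := iS _ Wv; have := x_le1 _ Wv.
    set t := rin (rho x (rho _ _)) _ => t1 it; apply: le_trans.
    (* With [e ^+ 2 <= 9^-1] this makes [t + e^2 (1 - t)^4] no smaller than its value at [i]. *)
    have AB : (1 - i) ^+ 4 - (1 - t) ^+ 4 <= 4 * (t - i).
      have -> : (1 - i) ^+ 4 - (1 - t) ^+ 4 =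
        ((1 - i + (1 - t)) * ((1 - i) ^+ 2 + (1 - t) ^+ 2)) * (t - i) by ring.
      rewrite ler_wpM2r ?subr_ge0//.
      have -> : (4 : R) = 2 * 2 by ring.
      have i2 : (1 - i) ^+ 2 <= 1 by rewrite expr2 mulr_ile1//; lra.
      have t2 : (1 - t) ^+ 2 <= 1 by rewrite expr2 mulr_ile1//; lra.
      apply: ler_pM; [lra| |lra|lra].
      by rewrite addr_ge0// sqr_ge0.
    have e9 : e ^+ 2 <= 9^-1.
      have -> : (9^-1 : R) = 3^-1 ^+ 2 by field.
      by rewrite lerXn2r ?nnegrE ?invr_ge0 ?(ltW e0).
    have e2 : 0 <= e ^+ 2 by exact: sqr_ge0.
    have := ler_wpM2l e2 AB.
    have ti : 0 <= t - i by rewrite subr_ge0.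
    have := ler_wpM2r ti e9.
    rewrite !mulrBr; move: (e ^+ 2 * (1 - i) ^+ 4) (e ^+ 2 * (1 - t) ^+ 4).
    by move: (e ^+ 2) => k p r; lra.
  rewrite gerDl pmulr_rle0 ?exprn_gt0// => i4.
  have : (1 - i) ^+ 4 = 0.
    by apply/le_anti; rewrite i4 -[4%N]/(2 * 2)%N exprM sqr_ge0.
  move=> /eqP; rewrite expf_eq0/= subr_eq0 => /eqP i1'; rewrite i1'.
  exact: iS.
apply: (act_inj vN) => u; rewrite (actM vN); apply: isometric_at => //.
set w := rho q u; have qw : rho q w = w by rewrite -(actM vN) qq.
have [->|w0] := eqVneq w 0; first by rewrite act0r.
have wp : 0 < rnorm w.
  by rewrite lt_def rnorm_ge0 andbT; apply: contra_neq w0; exact: rnorm0_eq0.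
apply/le_anti; rewrite contraction_act//=.
have ww : rnorm ((rnorm w)^-1%:C%C *: w) = 1.
  by rewrite rnormZr gtr0_norm ?invr_gt0// mulVf// gt_eqF.
have Ww : W ((rnorm w)^-1%:C%C *: w) by split; rewrite ?actZr// qw.
have := xW _ Ww; rewrite actZr// rinZl rinZr mulrA -invfM mulrC.
rewrite ler_pdivlMr ?mulr_gt0// mul1r -expr2 -rinxx => wx.
by rewrite rnorm_le_sqr.
Qed.

End perturbation.

(** A midpoint is a C*-convex combination with scalar coefficients. *)
Lemma cstar_extreme_midpoint (R : realType) (B : cstarAlgType R) (x y z : B) :
  cstar_extreme_point x -> rnorm y <= 1 -> rnorm z <= 1 -> y + z = x + x ->
  exists2 u, unitary u & y = star u * x * u.
Proof.
move=> [_ xext] y1 z1 yz.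
(* Four weights [1/2] rather than two weights [1/sqrt 2]. *)
pose t := (2^-1)%:C%C *: (1 : B); pose t' := 2%:C%C *: (1 : B).
have ttE (c : B) : star t * c * t = ((2^-1) * 2^-1)%:C%C *: c.
  by rewrite /t starZr star1 !cscale_mull mul1r cscale_mulr mulr1 scalerA -rmorphM.
have c4 (c : B) : (2^-1 * 2^-1 : R)%:C%C *: (c + c + (c + c)) = c.
  have c2 (d : B) : d + d = 2%:C%C *: d.
    by rewrite [2%:C%C]rmorphD/= scalerDl scale1r.
  rewrite !c2 !scalerA -!rmorphM/=.
  by rewrite (_ : _ * _ = 1 :> R) ?scale1r//; field.
have [i|i|||u uP] :=
  xext 4 (fun i : 'I_4 => if odd i then z else y) (fun=> t).
- by case: ifP; rewrite norm_le1E.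
- exists t'; rewrite /t /t' !cscale_mull !cscale_mulr !mulr1 !scalerA -!rmorphM/=.
  by rewrite mulVf ?pnatr_eq0// mulfV ?pnatr_eq0// !scale1r.
- rewrite (eq_bigr (fun=> (2^-1 * 2^-1 : R)%:C%C *: (1 : B))).
    rewrite !big_ord_recl big_ord0 addr0 -!scalerDr.
    by rewrite -[RHS]c4 addrA.
  by move=> i _; rewrite -[star t]mulr1 ttE.
- rewrite !big_ord_recl big_ord0 addr0/= !ttE -!scalerDr.
  by rewrite (addrA y) yz c4.
have [U0 y0] := uP ord0.
by exists (u ord0).
Qed.

(** * Evaluation of an extreme function at a point *)

Section extreme_values.
Context {R : realType} {Omega : topologicalType} (cO : compact [set: Omega]).
Context {M : cstarAlgType R} {H : hilbertType R} {rho : M -> H -> H}.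
Hypothesis vN : von_neumann_algebra rho.
Implicit Types f g : contfun M cO.

Definition contfun_const (c : M) : contfun M cO :=
  @ContFun R Omega M cO (fun=> c) (asboolT (fun w => cvg_cst c)).

Lemma contfun_unitary_at f w : unitary f -> unitary (f w).
Proof.
move=> [f1 f2]; split.
  exact: (congr1 (fun g : contfun M cO => g w) f1).
exact: (congr1 (fun g : contfun M cO => g w) f2).
Qed.

(** The perturbations with [e] and [- e] are made in the function algebra, where [f] is their
    midpoint; the resulting unitary equivalence is then evaluated at [w]. *)
Lemma contfun_extreme_perturbation f w (c : M) (e : R) :
  cstar_extreme_point f -> rnorm c <= 1 -> 0 <= e <= 3^-1 ->
  exists2 u, unitary u &
    f w + e%:C%C *: ((1 - f w * star (f w)) * c * (1 - star (f w) * f w)) =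
    star u * f w * u.
Proof.
move=> fext c1 /andP[e0 e3].
have f1 v : rnorm (f v) <= 1.
  by rewrite -norm_le1E; apply: le_trans (contfun_norm_ub f v) fext.1.
pose p := (1 - f * star f) * contfun_const c * (1 - star f * f).
have le1 (s : R) : `|s| <= 3^-1 -> rnorm (f + s%:C%C *: p) <= 1.
  move=> s3; rewrite -norm_le1E; apply: contfun_norm_le => // v.
  rewrite norm_le1E.
  exact: (perturbation_le vN (f1 v) c1 s3).
have [|||u uu yu] :=
  @cstar_extreme_midpoint _ _ f (f + e%:C%C *: p) (f + (- e)%:C%C *: p) fext.
- by apply: le1; rewrite ger0_norm.
- by apply: le1; rewrite normrN ger0_norm.
- by rewrite addrACA -scalerDl -rmorphD/= subrr scale0r addr0.
exists (u w); first exact: contfun_unitary_at.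
exact: (congr1 (fun g : contfun M cO => g w) yu).
Qed.

(** [1 - v* v] is a projection, so [|u|^2 - |v u|^2 = |(1 - v* v) u|^2]. *)
Lemma partial_isometry_le1 (v : M) : v * star v * v = v -> rnorm v <= 1.
Proof.
move=> vv; apply: (le_act vN) => // u; rewrite mul1r rnorm_le_sqr.
have := rinxx_ge0 (rho (1 - star v * v) u).
rewrite (actBl vN) (act1 vN) !rinE (rinC _ u) (rin_act_star vN).
rewrite (rin_gram vN (star v * v)) starMr starK.
have -> : star v * v * (star v * v) = star v * v by rewrite -mulrA (mulrA v) vv.
rewrite -(rin_gram vN v v); lra.
Qed.

Lemma contfun_extreme_value f w : cstar_extreme_point f ->
  exists q, [/\ central_projection q, star (f w) * f w * q = q
    & f w * star (f w) * (1 - q) = 1 - q].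
Proof.
move=> fext; set x := f w.
have x1 : rnorm x <= 1.
  by rewrite -norm_le1E; apply: le_trans (contfun_norm_ub f w) fext.1.
have [r [sr rr rc r0]] := absolute_value vN x.
(* The polar decomposition as a relation; a maximal extension gives [x = v * r]. *)
pose G0 := [set (rho r u, rho x u) | u in [set: H]].
have [|v [vv vG vmax]] := @partial_isometry_exists _ _ _ _ vN G0.
  split=> [_ _ [u1 _ <-] [u2 _ <-]/=|T _ NT [u _ <-]/=].
    by rewrite !(rin_gram vN) sr rr.
  by exists (T u) => //; rewrite !(commutant_act _ _ NT).
have vr : v * r = x.
  apply: (act_inj vN) => u; rewrite (actM vN).
  by have [] := vG (rho r u, rho x u) (imageP _ I).
have vvr : star v * v * r = r.
  apply: (act_inj vN) => u; rewrite (actM vN).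
  by have [] := vG (rho r u, rho x u) (imageP _ I).
have rvv : r * star v * v = r.
  by have := congr1 star vvr; rewrite !starMr sr starK mulrA.
have v1 := partial_isometry_le1 vv.
have xE : star x = r * star v by rewrite -vr starMr sr.
have xx : star x * x = r * r by [].
have bv : (1 - x * star x) * v = v * (1 - star x * x).
  rewrite xx mulrBl mulrBr mul1r mulr1; congr (_ - _).
  by rewrite xE -vr -!mulrA (mulrA r (star v)) rvv.
have [q [cq vq vq']] := central_splitting vN vmax.
have e0 : 0 < 3^-1 :> R by rewrite invr_gt0.
have [|u uu yu] := contfun_extreme_perturbation w fext v1 (e := 3^-1).
  by rewrite (ltW e0) lexx.
exists q; split=> //.
  apply: (rigid_isometric vN e0 _ x1 cq vq _ bv uu yu) => // u0.
  by rewrite -vr mulrA vvr.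
(* The same argument for [star x], with [star v], [1 - q] and the adjoint of [yu]; here the positive
   element is [v * r * star v]. *)
rewrite -[X in X * star x]starK.
apply: (rigid_isometric vN e0 _ _ (central_projectionC cq) _ _ _ uu
  (v := star v)) => //.
- by rewrite rnorm_star.
- by rewrite starK.
- by move=> u0; rewrite starK xE !(actM vN) -(adjr vN).
- rewrite !starK; have := congr1 star bv.
  by rewrite !starMr !starB star1 !starMr !starK => ->.
- have := congr1 star yu.
  rewrite -/x starD starZr !starMr !starB star1 !starMr !starK => yu'.
  by rewrite !mulrA in yu' *.
Qed.

End extreme_values.

(** * Similar isometries *)

Lemma star_mul_eq0 (R : realType) (A : cstarAlgType R) (x : A) :
  star x * x = 0 -> x = 0.
Proof.
move=> xx; apply/normr0_eq0/eqP; rewrite -sqrf_eq0; apply/eqP.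
by rewrite -cstar_norm -[cmul _ _]/(star x * x) xx normr0.
Qed.

Lemma star_orth (R : realType) (A : cstarAlgType R) (x y : A) :
  star x * y = 0 -> star y * x = 0.
Proof. by move=> xy; rewrite -[LHS]starK starMr starK xy star0. Qed.

Lemma starX (R : realType) (A : cstarAlgType R) (x : A) n :
  star (x ^+ n) = star x ^+ n.
Proof.
by elim: n => [|n IH]; [rewrite !expr0 star1|rewrite exprS exprSr starMr IH].
Qed.

(** The factor [q] matters at [n = 0], where the powers of [v] are [1] and not [q]. *)
Lemma star_mulX (R : realType) (A : cstarAlgType R) (v q : A) :
  star v * v = q -> q * q = q -> q * v = v ->
  forall n, star v ^+ n * v ^+ n * q = q.
Proof.
move=> vv qq qv.
elim=> [|n IH]; first by rewrite !expr0 !mul1r.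
rewrite exprSr exprS -[star v ^+ n * star v * _]mulrA (mulrA (star v)) vv.
case: n IH => [|n] IH; first by rewrite !expr0 mul1r mulr1.
by rewrite [v ^+ n.+1]exprS (mulrA q) qv -exprS.
Qed.

Lemma star_mulXS (R : realType) (A : cstarAlgType R) (v q : A) :
  star v * v = q -> q * q = q -> q * v = v ->
  forall n, star v ^+ n * v ^+ n.+1 = v.
Proof.
by move=> vv qq qv n; rewrite exprSr -{3}qv !mulrA (star_mulX vv).
Qed.

(** * Wold decomposition *)

Section wold.
Context {R : realType} {H : hilbertType R} {M : cstarAlgType R}.
Context {rho : M -> H -> H} (vN : von_neumann_algebra rho).
Implicit Types (u : H) (x y z c d p q v w : M).

Local Notation N := (commutant (range rho)).

(** [p] projects onto the intersection of the ranges of all [v ^+ n]. It commutes with [v] because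
    [v] and [star v] both map this intersection into itself. *)
Lemma unitary_part q v : star v * v = q -> q * v = v -> v * q = v ->
  exists p, [/\ star p = p, p * p = p, p * v = v * p,
    forall n, v ^+ n * star v ^+ n * p = p
    & forall z, (forall n, v ^+ n * star v ^+ n * z = z) -> p * z = z].
Proof.
move=> vv qv vq.
have sq : star q = q by rewrite -vv starMr starK.
pose K := [set u | forall n, rho (v ^+ n * star v ^+ n - 1) u = 0].
have KE u : K u <-> forall n, rho (v ^+ n * star v ^+ n) u = u.
  split=> Ku n; first by apply/subr0_eq; have := Ku n; rewrite actBl// act1.
  by rewrite actBl// act1// Ku subrr.
have [|||p [sp pp pK]] := @projection_exists _ _ _ _ vN K.
- split=> [n|a u1 u2 K1 K2 n]; first by rewrite act0r.
  by rewrite actDr// actZr// K1 K2 scaler0 addr0.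
- move=> f u Kf fu n.
  by apply: (tends_closed (act_lip vN _) fu) => k; exact: Kf.
- move=> T u NT Ku n; rewrite -(commutant_act _ _ NT) Ku.
  by have [_ _ TB] := op_linear NT.1; have := TB 0 0; rewrite !subrr.
have Kp u : K (rho p u) by apply/pK; rewrite -(actM vN) pp.
have vvp n : v ^+ n * star v ^+ n * p = p.
  by apply: (act_inj vN) => u; rewrite (actM vN); have /KE := Kp u; apply.
have pz z : (forall n, v ^+ n * star v ^+ n * z = z) -> p * z = z.
  move=> vz; apply: (act_inj vN) => u; rewrite (actM vN); apply/pK/KE => n.
  by rewrite -(actM vN) vz.
have qp : q * p = p by rewrite -(vvp 1%N) !expr1 !mulrA qv.
have qvn n : v ^+ n.+1 = q * v ^+ n.+1 by rewrite exprS mulrA qv.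
have pvp : p * (v * p) = v * p.
  apply: pz => -[|n]; first by rewrite !expr0 !mul1r.
  rewrite [star v ^+ _]exprSr exprS !mulrA -(mulrA _ (star v) v) vv.
  by rewrite -(mulrA _ q) qp -!mulrA (mulrA (v ^+ n)) vvp.
have pvp' : p * (star v * p) = star v * p.
  apply: pz => -[|n]; first by rewrite !expr0 !mul1r.
  have e1 : v ^+ n.+1 = star v * v ^+ n.+2.
    by rewrite [v ^+ n.+2]exprS mulrA vv -qvn.
  have e2 : star v ^+ n.+1 * (star v * p) = star v ^+ n.+2 * p.
    by rewrite [star v ^+ n.+2]exprSr mulrA.
  by rewrite -mulrA e2 {1}e1 -[star v * _ * _]mulrA (mulrA (v ^+ n.+2)) vvp.
exists p; split=> //.
by rewrite -pvp mulrA -[LHS]starK starMr sp -pvp' !starMr sp starK.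
Qed.

(** Equal Gram elements mean [|r u| = |d u|] for every [u], hence equal kernels. *)
Lemma gram_ker d r c : star r * r = star d * d -> r * c = 0 -> d * c = 0.
Proof.
move=> rd rc; apply: star_mul_eq0; rewrite starMr.
have -> : star c * star d * (d * c) = star c * (star d * d) * c by rewrite !mulrA.
by rewrite -rd -!mulrA rc !mulr0.
Qed.

(** [v] is isometric on the range of [q], and the range of [c] is orthogonal to that of [v]; hence
    its translates by powers of [v] are mutually orthogonal. *)
Lemma wandering q v c : central_projection q -> star v * v = q -> q * v = v ->
  q * c = c -> star v * c = 0 -> forall m k,
  star (v ^+ m * c) * (v ^+ (m + k) * c) = if k == 0%N then star c * c else 0.
Proof.
move=> [sq qq qx] vv qv qc vc m k.
have h : v ^+ k * c = q * (v ^+ k * c) by rewrite mulrA qx -mulrA qc.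
have -> : star (v ^+ m * c) * (v ^+ (m + k) * c) = star c * (v ^+ k * c).
  rewrite exprD starMr starX -!mulrA h; congr (_ * _).
  by rewrite !mulrA star_mulX.
case: k h => [_|k _]; first by rewrite expr0 mul1r.
rewrite exprS -mulrA mulrA.
have -> : star c * v = 0 by rewrite -[v]starK -starMr vc star0.
by rewrite mul0r.
Qed.

(* The isometries [v = x * q] and [om = w * q] are similar through s. By the
   Wold decomposition it suffices to match separately the unitary parts (via
   the polar decomposition of [s * p]) and the wandering subspaces (via that of
   [star s^-1 * e], as [star s^-1] intertwines [star v] and [star om]). *)
Lemma similar_isometries x w s s' q : central_projection q ->
  star x * x * q = q -> star w * w * q = q -> s * s' = 1 -> s' * s = 1 ->
  w * s * q = s * x * q ->
  exists u : M, [/\ star u * u = q, u * star u = q, u * q = u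
    & u * x * star u = w * q].
Proof.
move=> cq xx ww ss' s's wsx; have [sq qq qx] := cq.
have [v vE] : exists v, v = x * q by exists (x * q).
have [om omE] : exists om, om = w * q by exists (w * q).
have isoq y z : z = y * q -> star y * y * q = q ->
    [/\ star z * z = q, q * z = z & z * q = z].
  move=> -> yy; split; last by rewrite -mulrA qq.
    by rewrite starMr sq mulrA -(mulrA q) -qx qx -mulrA yy.
  by rewrite qx -mulrA qq.
have [vv qv vq] := isoq _ _ vE xx; have [oo qo oq] := isoq _ _ omE ww.
have sv : s * v = om * s by rewrite vE omE mulrA -wsx -mulrA -qx mulrA.
have s'o : s' * om = v * s'.
  by rewrite -[LHS]mulr1 -ss' mulrA -(mulrA s') -sv mulrA s's mul1r.
set A := star s'.
have sA : star s * A = 1 by rewrite -starMr s's star1.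
have As : A * star s = 1 by rewrite -starMr ss' star1.
have Av : A * star v = star om * A by rewrite -!starMr s'o.
(* [e] projects onto the wandering subspace of [v], the kernel of [star v] in the range of [q]. *)
have [e eE] : exists e, e = q - v * star v by exists (q - v * star v).
have se : star e = e by rewrite eE starB starMr starK sq.
have ve : star v * e = 0.
  by rewrite eE mulrBr mulrA vv -qx subrr.
have ev : e * v = 0 by rewrite -[v]starK -se -starMr ve star0.
have qe : q * e = e by rewrite eE mulrBr qq mulrA qv.
have eq : e * q = e by rewrite -qx.
have ee : e * e = e by rewrite {2}eE mulrBr eq mulrA ev mul0r subr0.
have [p [sp pp pv vvp pz]] := unitary_part vv qv vq.
have pvs : p * star v = star v * p.
  by rewrite -[LHS]starK starMr sp starK -pv starMr sp.
have qp : q * p = p by rewrite -(vvp 1%N) !expr1 !mulrA qv.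
(* [g] carries the wandering subspace of [v] into that of [om], and [B] intertwines [v] and [om] on
   the unitary part. On that part [B] also intertwines the adjoints, so the absolute value [r2] of
   [B] commutes with [v]. *)
have [g gE] : exists g, g = A * e by exists (A * e).
have [B BE] : exists B, B = s * p by exists (s * p).
have og : star om * g = 0 by rewrite gE mulrA -Av -mulrA ve mulr0.
have qg : q * g = g by rewrite gE mulrA qx -mulrA qe.
have Bv : B * v = om * B by rewrite BE -mulrA pv !mulrA sv.
have Bvs : B * star v = star om * B.
  have vvp1 : v * (star v * p) = p by have := vvp 1%N; rewrite !expr1 mulrA.
  have -> : star om * B = star om * (s * v * (star v * p)).
    by rewrite -mulrA vvp1 BE.
  rewrite sv BE -mulrA pvs !mulrA oo (qx s) -(mulrA s q) (qx (star v)).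
  by rewrite -!mulrA qp.
have BBv : v * (star B * B) = star B * B * v.
  have vB : v * star B = star B * om.
    by rewrite -[om]starK -starMr -Bvs starMr starK.
  by rewrite mulrA vB -!mulrA Bv.
have [r1 [sr1 rr1 _ _]] := absolute_value vN g.
have [r2 [sr2 rr2 r2c _]] := absolute_value vN B.
have r2v : v * r2 = r2 * v by exact: r2c.
have {}rr1 : star r1 * r1 = star g * g by rewrite sr1.
have {}rr2 : star r2 * r2 = star B * B by rewrite sr2.
have r1e : r1 * e = r1.
  apply/esym/subr0_eq; rewrite -{1}[r1]mulr1 -mulrBr; apply: (gram_ker (esym rr1)).
  by rewrite gE mulrBr mulr1 -mulrA ee subrr.
have er1 : e * r1 = r1 by rewrite -{1}se -sr1 -starMr r1e.
have r2p : r2 * p = r2.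
  apply/esym/subr0_eq; rewrite -{1}[r2]mulr1 -mulrBr; apply: (gram_ker (esym rr2)).
  by rewrite BE mulrBr mulr1 -mulrA pp subrr.
have pr2 : p * r2 = r2 by rewrite -{1}sp -sr2 -starMr r2p.
have vr1 : star v * r1 = 0 by rewrite -er1 mulrA ve mul0r.
have qr1 : q * r1 = r1 by rewrite -er1 mulrA qe.
have assoc5 a b c d f : a * b * (c * d * f) = a * (b * c) * (d * f) :> M.
  by rewrite !mulrA.
have evp n : e * star v ^+ n * p = 0.
  by rewrite -(vvp n.+1) assoc5 (star_mulXS vv)// ev mul0r.
have svX n : s * v ^+ n = om ^+ n * s.
  elim: n => [|n IH]; first by rewrite !expr0 mulr1 mul1r.
  by rewrite !exprS mulrA sv -mulrA IH mulrA.
have s'oX n : s' * om ^+ n = v ^+ n * s'.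
  by rewrite -[LHS]mulr1 -ss' mulrA -(mulrA s') -svX mulrA s's mul1r.
have go : star g * om = 0 by rewrite -[om]starK -starMr og star0.
(* Shift parts are orthogonal to unitary parts, for [v] here and for [om] in [cross2]. *)
have cross1 n : star (v ^+ n * r1) * r2 = 0.
  rewrite starMr starX sr1.
  have -> : r1 * star v ^+ n * r2 = r1 * (e * star v ^+ n * p) * r2.
    by rewrite !mulrA r1e -(mulrA _ p) pr2.
  by rewrite evp mulr0 mul0r.
have cross2 n : star (om ^+ n * g) * B = 0.
  have -> : B = om ^+ n.+1 * (s * (star v ^+ n.+1 * p)).
    by rewrite mulrA -svX -mulrA (mulrA (v ^+ _)) vvp BE.
  rewrite starMr starX -mulrA (mulrA (star om ^+ n)) (star_mulXS oo)//.
  by rewrite mulrA go mul0r.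
have same n m : star (v ^+ m * r1) * (v ^+ n * r1) =
    star (om ^+ m * g) * (om ^+ n * g).
  have le k i : star (v ^+ i * r1) * (v ^+ (i + k) * r1) =
      star (om ^+ i * g) * (om ^+ (i + k) * g).
    by rewrite (wandering cq)// (wandering cq)// rr1.
  have [mn|/ltnW nm] := leqP m n; first by rewrite -(subnKC mn) le.
  rewrite -[LHS]starK -[RHS]starK (starMr (star _)) [in RHS](starMr (star _)).
  by rewrite !(starK (_ * _)) -(subnKC nm) le.
(* Wandering subspaces are matched by the polar part of [g] and moved along by powers of [v] and
   [om]; unitary parts are matched by the polar part of [B]. *)
pose G0 := [set a | (exists n u, a = (rho (v ^+ n * r1) u, rho (om ^+ n * g) u))
  \/ (exists u, a = (rho r2 u, rho B u))].
have [|u0 [uu uG _]] := @partial_isometry_exists _ _ _ _ vN G0.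
  split.
    move=> _ _ [[n [u ->]]|[u ->]] [[m [u' ->]]|[u' ->]] /=; rewrite !(rin_gram vN).
    - by rewrite same.
    - by rewrite (star_orth (cross1 _)) (star_orth (cross2 _)).
    - by rewrite cross1 cross2.
    - by rewrite rr2.
  move=> T _ NT [[n [u ->]]|[u ->]] /=; rewrite !(commutant_act _ _ NT).
    by left; exists n, (T u).
  by right; exists (T u).
have u0v n : u0 * (v ^+ n * r1) = om ^+ n * g /\
    star u0 * u0 * (v ^+ n * r1) = v ^+ n * r1.
  split; apply: (act_inj vN) => u; rewrite (actM vN);
    have [] := uG (rho (v ^+ n * r1) u, rho (om ^+ n * g) u); try done.
  - by left; exists n, u.
  - by left; exists n, u.
have u0r : u0 * r2 = B /\ star u0 * u0 * r2 = r2.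
  split; apply: (act_inj vN) => u; rewrite (actM vN);
    have [] := uG (rho r2 u, rho B u); try done.
  - by right; exists u.
  - by right; exists u.
(* The initial vectors of [G0] span a dense subspace of the range of [q]: what is orthogonal to all
   shifted wandering vectors lies in the unitary part, where [B] is injective. *)
have domT c : (forall n, c * (v ^+ n * r1) = 0) -> c * r2 = 0 -> c * q = 0.
  move=> cv cr; set z := q * star c.
  have qz : q * z = z by rewrite mulrA qq.
  have ez n : e * (star v ^+ n * z) = 0.
    have r1c : r1 * (star v ^+ n * star c) = 0.
      by rewrite -sr1 -starX mulrA -!starMr cv star0.
    have := gram_ker rr1 r1c; rewrite gE -mulrA => /(congr1 ( *%R (star s))).
    rewrite mulr0 mulrA sA mul1r => ec.
    by rewrite /z qx (mulrA (star v ^+ n)) mulrA ec mul0r.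
  have vz n : v ^+ n * star v ^+ n * z = z.
    elim: n => [|n IH]; first by rewrite !expr0 !mul1r.
    rewrite exprSr exprS; have -> : v ^+ n * v * (star v * star v ^+ n) * z =
      v ^+ n * (v * star v) * (star v ^+ n * z) by rewrite !mulrA.
    have -> : v * star v = q - e by rewrite eE opprB addrC subrK.
    rewrite mulrBr mulrBl -(mulrA _ e) ez mulr0 subr0 -mulrA (mulrA q) qx.
    by rewrite -(mulrA _ q) qz mulrA IH.
  have Bc : B * star c = 0.
    by apply: (gram_ker rr2); rewrite -sr2 -starMr cr star0.
  have z0 : z = 0.
    rewrite -[z]mul1r -s's -mulrA -(pz _ vz) (mulrA s) -BE /z (mulrA B) -qx.
    by rewrite -mulrA Bc !mulr0.
  by rewrite -[c]starK -sq -starMr -/z z0 star0.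
(* Density of the final vectors. The range of [g] contains that of [f], the projection onto the
   wandering subspace of [om], and [s'] carries the remaining vectors into the unitary part of
   [v]. *)
have ranT c : (forall n, c * (om ^+ n * g) = 0) -> c * B = 0 -> c * q = 0.
  move=> co cB; set z := q * star c.
  have qz : q * z = z by rewrite mulrA qq.
  have gz n : star g * (star om ^+ n * z) = 0.
    rewrite /z qx (mulrA (star om ^+ n)) mulrA -starX mulrA -!starMr.
    by rewrite co star0 mul0r.
  have [f fE] : exists f, f = q - om * star om by exists (q - om * star om).
  have sf : star f = f by rewrite fE starB starMr starK sq.
  have of0 : star om * f = 0 by rewrite fE mulrBr mulrA oo -qx subrr.
  have qf : q * f = f by rewrite fE mulrBr qq mulrA qo.
  have ff : f * f = f.
    rewrite {1}fE mulrBl qf -mulrA of0 mulr0 subr0.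
    by [].
  have fz n : f * (star om ^+ n * z) = 0.
    set Y := star om ^+ n * z; apply: star_mul_eq0.
    rewrite starMr sf -mulrA (mulrA f) ff.
    have -> : f * Y = g * (star s * (f * Y)).
      rewrite gE -mulrA eE mulrBl (mulrA q) qx -(mulrA _ q) (mulrA q) qf.
      rewrite -(mulrA v) (mulrA (star v)) -starMr sv starMr.
      by rewrite -(mulrA (star s)) (mulrA (star om)) of0 mul0r !mulr0 subr0
        (mulrA A) As mul1r.
    by rewrite mulrA -[X in _ * X * _]starK -starMr gz star0 mul0r.
  have oz n : om ^+ n * (star om ^+ n * z) = z.
    elim: n => [|n IH]; first by rewrite !expr0 !mul1r.
    rewrite exprSr exprS; have -> : om ^+ n * om * (star om * star om ^+ n * z) =
      om ^+ n * ((om * star om) * (star om ^+ n * z)) by rewrite !mulrA.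
    have -> : om * star om = q - f by rewrite fE opprB addrC subrK.
    by rewrite mulrBl fz subr0 (mulrA q) qx -(mulrA _ q) qz IH.
  have pz' : p * (s' * z) = s' * z.
    apply: pz => n; have qY : q * (s' * (star om ^+ n * z)) = s' * (star om ^+ n * z).
      by rewrite mulrA qx -mulrA (mulrA q) qx -(mulrA _ q) qz.
    rewrite -{1}(oz n) (mulrA s') s'oX -(mulrA _ s') -qY.
    rewrite -mulrA (mulrA (star v ^+ n)) (mulrA _ q) (star_mulX vv)// qY.
    by rewrite mulrA -s'oX -mulrA oz.
  have z0 : z = 0.
    apply: star_mul_eq0; rewrite -[X in _ * X]mul1r -ss' -mulrA -pz'.
    rewrite (mulrA s) -BE mulrA -[B]starK -starMr /z (mulrA (star B)) -qx.
    by rewrite -mulrA -starMr cB star0 mulr0 star0 mul0r.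
  by rewrite -[c]starK -sq -starMr -/z z0 star0.
(* By density the identities for [u] need only be tested on the vectors of [G0]. *)
have Eq : star u0 * u0 * q = q.
  apply/esym/subr0_eq; rewrite -[X in X - _]mul1r -mulrBl; apply: domT => [n|].
    by rewrite mulrBl mul1r (u0v n).2 subrr.
  by rewrite mulrBl mul1r u0r.2 subrr.
have Fq : u0 * star u0 * q = q.
  apply/esym/subr0_eq; rewrite -[X in X - _]mul1r -mulrBl; apply: ranT => [n|].
    by rewrite mulrBl mul1r -(u0v n).1 (mulrA (u0 * _)) uu subrr.
  by rewrite mulrBl mul1r -u0r.1 (mulrA (u0 * _)) uu subrr.
have uv : u0 * v * q = om * u0 * q.
  apply/subr0_eq; rewrite -mulrBl; apply: domT => [n|].
    rewrite mulrBl -!mulrA (u0v n).1 (mulrA v) -exprS (u0v n.+1).1.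
    by rewrite exprS mulrA subrr.
  by rewrite mulrBl -!mulrA r2v (mulrA u0 r2) u0r.1 Bv subrr.
exists (u0 * q); split.
- by rewrite starMr sq mulrA -(mulrA q) -mulrA Eq qq.
- by rewrite starMr sq mulrA -(mulrA u0) qq -qx -mulrA qx.
- by rewrite -mulrA qq.
rewrite starMr sq.
have -> : u0 * q * x * (q * star u0) = u0 * v * q * star u0.
  by rewrite vE -!mulrA (mulrA q x) qx -mulrA (mulrA q q) qq.
by rewrite uv -mulrA qx -!mulrA (mulrA u0) Fq oq omE.
Qed.

End wold.

(** * C*-convex combinations *)

Section cstar_convex_combinations.
Context {R : realType} {H : hilbertType R} {M : cstarAlgType R}.
Context {rho : M -> H -> H} (vN : von_neumann_algebra rho).
Implicit Types (u : H) (x q : M).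

Lemma act_sum (k : nat) (F : 'I_k -> M) u :
  rho (\sum_(i < k) F i) u = \sum_(i < k) rho (F i) u.
Proof.
elim/big_ind2: _ => [|x v y w <- <-|//]; first exact: (act0l vN).
by rewrite (actDl vN).
Qed.

Lemma rin_suml (k : nat) (F : 'I_k -> H) u :
  rin (\sum_(i < k) F i) u = \sum_(i < k) rin (F i) u.
Proof.
elim/big_ind2: _ => [|x v y w <- <-|//]; first exact: rin0l.
by rewrite rinDl.
Qed.

(* For u in the range of q,
   sum |x_i t_i u - t_i x u|^2 = sum |x_i t_i u|^2 - |x u|^2
                              <= sum |t_i u|^2 - |u|^2 = 0. *)
Lemma isometric_combination x q (k : nat) (xs ts : 'I_k -> M) :
  central_projection q -> star x * x * q = q ->
  (forall i, rnorm (xs i) <= 1) -> (forall i, invertible (ts i)) ->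
  \sum_(i < k) star (ts i) * ts i = 1 ->
  x = \sum_(i < k) star (ts i) * xs i * ts i ->
  forall i, xs i * ts i * q = ts i * x * q /\ star (xs i) * xs i * q = q.
Proof.
move=> [sq qq qx] xx xs1 tinv t1 xE.
have key u i : rho q u = u ->
    rho (xs i) (rho (ts i) u) = rho (ts i) (rho x u) /\
    rnorm (rho (xs i) (rho (ts i) u)) = rnorm (rho (ts i) u).
  move=> qu.
  pose D j := rho (xs j) (rho (ts j) u) - rho (ts j) (rho x u).
  pose n1 j := rin (rho (ts j) u) (rho (ts j) u).
  pose n2 j := rin (rho (xs j) (rho (ts j) u)) (rho (xs j) (rho (ts j) u)).
  have xu : rin (rho x u) (rho x u) = rin u u.
    by rewrite (rin_gram vN) -{1}qu -(actM vN) xx qu.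
  have n21 j : n2 j <= n1 j.
    by rewrite -rnorm_le_sqr; exact: (contraction_act vN).
  have tt v : \sum_(j < k) rin (rho (ts j) v) (rho (ts j) v) = rin v v.
    rewrite -{3}(act1 vN v) -t1 act_sum rin_suml.
    apply: eq_bigr => j _.
    by rewrite (actM vN) (adjl vN).
  have tx : \sum_(j < k) rin (rho (xs j) (rho (ts j) u)) (rho (ts j) (rho x u)) =
      rin u u.
    rewrite -xu {2}xE act_sum rin_suml; apply: eq_bigr => j _.
    by rewrite !(actM vN) (adjl vN).
  have sum0 : \sum_(j < k) (rin (D j) (D j) + (n1 j - n2 j)) = 0.
    transitivity (\sum_(j < k) rin (rho (ts j) u) (rho (ts j) u)
       + \sum_(j < k) rin (rho (ts j) (rho x u)) (rho (ts j) (rho x u))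
       - 2 * \sum_(j < k) rin (rho (xs j) (rho (ts j) u)) (rho (ts j) (rho x u))).
      rewrite mulr_sumr -sumrN -!big_split /=; apply: eq_bigr => j _.
      rewrite /D /n1 /n2 !rinE (rinC (rho (ts j) (rho x u)) (rho (xs j) _)).
      by ring.
    by rewrite !tt tx xu; ring.
  have term0 : forall j, true -> rin (D j) (D j) + (n1 j - n2 j) = 0.
    move=> j _; have := @psumr_eq0P _ _ predT _ _ sum0; apply=> // l _.
    by rewrite addr_ge0 ?rinxx_ge0 ?subr_ge0.
  have := term0 i isT; have := n21 i; have := rinxx_ge0 (D i) => h1 h2 h3.
  have D0 : rin (D i) (D i) = 0 by lra.
  split; first by apply/subr0_eq; exact: rin0_eq0.
  by apply/le_anti; rewrite !rnorm_le_sqr -/(n1 i) -/(n2 i); lra.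
move=> i; split.
  apply: (act_inj vN) => u; rewrite !(actM vN).
  by have [] := key (rho q u) i; rewrite -?(actM vN) ?qq.
(* As [q] is central and [ts i] invertible, every vector in the range of [q] is [ts i] applied to
   one in that range; so [xs i] is isometric there. *)
have [s [st ts']] := tinv i.
apply: (act_inj vN) => u; rewrite (actM vN); apply: (isometric_at vN) => //.
have [|_] := key (rho s (rho q u)) i.
  by rewrite -(actM vN q s) qx (actM vN) -(actM vN q q) qq.
by rewrite -(actM vN (ts i)) ts' (act1 vN).
Qed.

(** [isometric_combination] and [similar_isometries] are applied to [x] on the range of [q] and to
    [star x] on that of [1 - q]. As [q] is central, the two resulting unitaries add up to a unitary
    of [M]. *)
Lemma split_isometry_extreme x q : rnorm x <= 1 -> central_projection q ->
  star x * x * q = q -> x * star x * (1 - q) = 1 - q ->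
  cstar_extreme_point x.
Proof.
move=> x1 cq xq xq'; split; first by rewrite norm_le1E.
move=> k xs ts xs1 tinv t1 xE.
have {}xs1 i : rnorm (xs i) <= 1 by rewrite -norm_le1E.
have cq' := central_projectionC cq.
have sxE : star x = \sum_(i < k) star (ts i) * star (xs i) * ts i.
  rewrite xE; elim/big_ind2: _ => [|a b c d <- <-|i _]; first exact: star0.
    exact: starD.
  by rewrite !starMr starK mulrA.
suff /choice[u uP] i : exists u : M, unitary u /\ xs i = star u * x * u by exists u.
have [s [st ts']] := tinv i.
have [tx xx] := isometric_combination cq xq xs1 tinv t1 xE i.
have [||tx' xx'] := isometric_combination cq' _ _ tinv t1 sxE i.
- by rewrite starK.
- by move=> j; rewrite rnorm_star.
rewrite starK in xx'.
have [u [u1 u2 uq ux]] := similar_isometries vN cq xq xx ts' st tx.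
have [||v [v1 v2 vq vx]] := similar_isometries vN cq' _ _ ts' st tx'.
- by rewrite starK.
- by rewrite starK.
have [sq qq qx] := cq; have [sq' qq' qx'] := cq'.
have q0 : q * (1 - q) = 0 by rewrite mulrBr mulr1 qq subrr.
(* Centrality of [q] makes all cross terms between the two summands vanish. *)
have orth (y : M) : u * y * star v = 0.
  by rewrite -uq -vq starMr sq' !mulrA -(mulrA u) qx -!mulrA
    (mulrA q) q0 mul0r !mulr0.
have orth' (y : M) : v * y * star u = 0.
  by have := congr1 star (orth (star y)); rewrite !starMr !starK star0 mulrA.
have orth2 : star u * v = 0.
  by rewrite -uq -vq starMr sq -qx' (qx (star u)) -mulrA (mulrA q) q0 mul0r mulr0.
have orth2' : star v * u = 0 by exact: star_orth.
exists (star (u + v)); split.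
  split; rewrite starK starD.
    rewrite mulrDl !mulrDr u2 v2.
    have := orth 1; have := orth' 1; rewrite !mulr1 => -> ->.
    by rewrite addr0 add0r addrC subrK.
  by rewrite mulrDl !mulrDr u1 v1 orth2 orth2' addr0 add0r addrC subrK.
have vx' : v * x * star v = xs i * (1 - q).
  have := congr1 star vx; rewrite !starMr !starK sq' qx' mulrA.
  by [].
rewrite starK starD !mulrDl !mulrDr orth orth' ux vx' addr0 add0r.
by rewrite -mulrDr addrC subrK mulr1.
Qed.

End cstar_convex_combinations.

Theorem corollary2p11 (R : realType) (Omega : topologicalType)
    (cO : compact [set: Omega]%classic) (hO : hausdorff_space Omega)
    (M : cstarAlgType R) (H : hilbertType R) (rho : M -> H -> H)
    (vN : von_neumann_algebra rho)
    (sep : separable_space (predual rho))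
    (rnp : radon_nikodym_property (predual rho))
    (f : contfun M cO) (hf : cstar_extreme_point f) (w : Omega) :
  cstar_extreme_point (f w).
Proof.
have [q [cq fq fq']] := contfun_extreme_value vN w hf.
apply: (split_isometry_extreme vN _ cq fq fq').
by rewrite -norm_le1E; apply: le_trans (contfun_norm_ub f w) hf.1.
Qed.
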